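(* Let $n\ge 1$ and $1\le k\le n$ be integers, let $\mu\in\mathbb{R}$, and let $\mu_0:=\sqrt{\frac{k}{n(k+1)(C_n^k)^{1/k}}}$. Suppose that $f\in C(\mathbb{R})$ satisfies: $f(t)>0$ and $f$ is monotonically non-decreasing on $(0,+\infty)$, and $f(t)=0$ for $t\in(-\infty,0]$. Suppose that either $k=1$ and $\mu\in(-\infty,\mu_0)$, or $2\le k\le n$ and $\mu\in[0,\mu_0)$. Then the equation $S_k^{1/k}(D^2u+\mu|Du|I)=f(u)$ in $\mathbb{R}^n$ admits a positive subsolution $u\in\Phi_\mu^k(\mathbb{R}^n)$ if and only if $$\int^{+\infty}\left(\int_{0}^{\tau}f^k(t)\,dt\right)^{-\frac{1}{k+1}}d\tau=+\infty.$$
   Context: $C_n^k$ denotes the binomial coefficient $\binom{n}{k}$. For $\lambda=(\lambda_1,\dots,\lambda_n)\in\mathbb{R}^n$, $S_k(\lambda)=\sum_{1\le i_1<\cdots<i_k\le n}\lambda_{i_1}\cdots\lambda_{i_k}$ is the $k$-th elementary symmetric function, and for a real symmetric $n\times n$ matrix $r$ with eigenvalues $\lambda(r)$, $S_k(r):=S_k(\lambda(r))$; $S_k^{1/k}$ is the $k$-th root of $S_k$. $Du$ and $D^2u$ are the gradient and Hessian of $u$, $|Du|$ is the Euclidean norm of the gradient, and $I$ is the $n\times n$ identity matrix. $\Gamma_k=\{\lambda\in\mathbb{R}^n: S_p(\lambda)>0 \text{ for all } p=1,\dots,k\}$. The class of admissible functions is $\Phi_\mu^k(\mathbb{R}^n)=\{u\in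 C^2(\mathbb{R}^n):\lambda(D^2u(x)+\mu|Du(x)|I)\in\Gamma_k\ \text{for all } x\in\mathbb{R}^n\}$. A subsolution $u\in\Phi_\mu^k(\mathbb{R}^n)$ of the equation $S_k^{1/k}(D^2u+\mu|Du|I)=f(u)$ in $\mathbb{R}^n$ is a function $u\in\Phi_\mu^k(\mathbb{R}^n)$ with $S_k^{1/k}(D^2u+\mu|Du|I)\ge f(u)$ at every point of $\mathbb{R}^n$; it is positive if $u>0$ in $\mathbb{R}^n$. In the integral $\int^{+\infty}$ the omitted lower limit is an arbitrary positive number. *)

(* Defs.v *)
From HB Require Import structures.
From mathcomp Require Import all_boot all_order all_algebra.
From mathcomp Require Import all_classical all_reals all_analysis.
Set Implicit Arguments.
Unset Strict Implicit.
Unset Printing Implicit Defensive.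
Import Order.TTheory GRing.Theory Num.Theory.
Import numFieldNormedType.Exports.
Local Open Scope classical_set_scope.
Local Open Scope ring_scope.

(* Points of R^n are row vectors. *)

Definition esym_poly (R : realType) (n k : nat) (lam : 'rV[R]_n) : R :=
  \sum_(A : {set 'I_n} | #|A| == k) \prod_(i in A) lam 0 i.

Definition Gamma (R : realType) (n k : nat) : set 'rV[R]_n :=
  [set lam | forall p : nat, (1 <= p <= k)%N -> 0 < esym_poly p lam].

(* A list of the eigenvalues of r, with multiplicity. Such a list exists when r
   is real symmetric and is then unique up to reordering, which affects neither
   esym_poly nor Gamma; if the characteristic polynomial does not split over R,
   the value is 0. *)
Definition eigenvalues (R : realType) (n : nat) (r : 'M[R]_n) : 'rV[R]_n :=
  xget 0 [set lam : 'rV[R]_n |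
    char_poly r = \prod_(i < n) ('X - (lam 0 i)%:P)].

Definition S_mx (R : realType) (n k : nat) (r : 'M[R]_n) : R :=
  esym_poly k (eigenvalues r).

Definition partial (R : realType) (n : nat) (i : 'I_n) (u : 'rV[R]_n -> R) :
  'rV[R]_n -> R := fun x => 'D_(delta_mx 0 i) u x.

Definition grad (R : realType) (n : nat) (u : 'rV[R]_n -> R) (x : 'rV[R]_n) :
  'rV[R]_n := \row_(i < n) partial i u x.

Definition hess (R : realType) (n : nat) (u : 'rV[R]_n -> R) (x : 'rV[R]_n) :
  'M[R]_n := \matrix_(i < n, j < n) partial j (partial i u) x.

(* The library norm on 'rV[R]_n is the sup norm, hence this definition. *)
Definition enorm (R : realType) (n : nat) (v : 'rV[R]_n) : R :=
  Num.sqrt (\sum_(i < n) v 0 i ^+ 2).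

(* Existence is required explicitly, since 'D_v u x is total. *)
Definition C1 (R : realType) (n : nat) (u : 'rV[R]_n -> R) : Prop :=
  continuous u /\
  forall i : 'I_n, (forall x, derivable u x (delta_mx 0 i)) /\
                   continuous (partial i u).

Definition C2 (R : realType) (n : nat) (u : 'rV[R]_n -> R) : Prop :=
  C1 u /\ forall i : 'I_n, C1 (partial i u).

Definition aug_hess (R : realType) (n : nat) (mu : R) (u : 'rV[R]_n -> R)
  (x : 'rV[R]_n) : 'M[R]_n := hess u x + (mu * enorm (grad u x))%:M.

Definition admissible (R : realType) (n k : nat) (mu : R)
  (u : 'rV[R]_n -> R) : Prop :=
  C2 u /\ forall x, Gamma k (eigenvalues (aug_hess mu u x)).

Definition subsolution (R : realType) (n k : nat) (mu : R) (f : R -> R)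
  (u : 'rV[R]_n -> R) : Prop :=
  admissible k mu u /\
  forall x, f (u x) <= S_mx k (aug_hess mu u x) `^ (k%:R^-1).

Definition mu0 (R : realType) (n k : nat) : R :=
  Num.sqrt (k%:R / (n%:R * k.+1%:R * ('C(n, k)%:R `^ (k%:R^-1)))).

(* Main.v *)
(* Both directions reduce to an autonomous equation [phi' = p (phi)], where [p]
   is a multiple of [P = (1 + F)^(1/(k+1))], [F(t)] is the integral of [f^k]
   over [0, t], and [G] is a primitive of [1 / P]; the integral condition says
   exactly that [G] is unbounded above.

   If [G] is unbounded, then [phi], the inverse of a multiple of [G], is defined
   on all of R, and [u x = phi ((exp (kap |x|^2 / 2) - 1) / kap)] is a
   subsolution. The exponential reparametrization absorbs a negative
   first-order term when [k = 1].

   If [G] is bounded and [u] is a positive subsolution, then for small [c] the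
   function [G (u x) / c - sqrt (1 + |x - x0|^2)] tends to -oo at infinity, hence
   attains its maximum. At a maximum point [D^2 u + mu |Du| I] is at most
   [b I + d g g^T] with [b] of order [p(u)], [d = p(u) p'(u)] and [|g| <= 1].
   Being in [Gamma_k], it then satisfies [S_k <= K (b + d) b^(k-1)], which for
   small [c] is less than [f(u)^k] as soon as [u] is large there. Bounded [u] are
   excluded by the same argument with a constant [p]. *)
Require Import Defs.
From HB Require Import structures.
From mathcomp Require Import all_boot all_order all_algebra.
From mathcomp Require Import all_classical all_reals all_analysis.
From mathcomp Require Import measurable_realfun.
From mathcomp Require Import perm ring lra zify.
Set Implicit Arguments.
Unset Strict Implicit.
Unset Printing Implicit Defensive.
Import Order.TTheory GRing.Theory Num.Theory.
Import numFieldNormedType.Exports.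
Local Open Scope classical_set_scope.
Local Open Scope ring_scope.

(** * Characteristic polynomials and elementary symmetric functions *)

(** The exponent 1/(k+1) comes from [phi'' = p' * p]: along the gradient such a profile contributes
    [p * p'] to the Hessian, and k - 1 further factors of order [p] come from the other directions,
    so [S_k] contains a term of order [p ^ k * p']. For [P ^ k.+1 = 1 + F] one has
    [P ^ k * P' = f ^ k / (k+1)], so a multiple of [P] makes this term comparable with [f ^ k]. The
    1 in [1 + F] keeps [P >= 1], so that [P] and [1 / P] are differentiable on the whole line
    although [F] vanishes for [t <= 0].

    The usual tool for bounding [S_k] from an upper bound on the matrix is monotonicity of [S_k] on
    [Gamma_k]. Here no matrix is diagonalized for that purpose: eigenvalues enter only through
    coefficients of characteristic polynomials. For k >= 2, positivity of S_1 and S_2 turns the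
    one-sided quadratic bound into two-sided bounds on all entries, and these bound every
    coefficient. *)

(** [J] is the set of factors that contribute their linear term. With [c = 1] this is Vieta's
    formula; with [c i] the indicator of [i == s i] it expands the Leibniz term of a permutation
    [s]. *)
Lemma coef_prod_linear (R : comNzRingType) (n m : nat) (c d : 'I_n -> R) :
  (\prod_(i < n) ((c i)%:P * 'X + (d i)%:P))`_m =
  \sum_(J : {set 'I_n} | #|J| == m)
    (\prod_(i in J) c i) * (\prod_(i in ~: J) d i).
Proof.
rewrite bigA_distr coef_sum [RHS]big_mkcond; apply: eq_bigr => J _ /=.
rewrite (bigID (mem J)) /= (eq_bigr (fun i => (c i)%:P * 'X)); last first.
  by move=> i ->.
rewrite [in X in _ * X](eq_bigr (fun i => (d i)%:P)); last first.
  by move=> i /negbTE ->.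
rewrite [in X in _ * X](eq_bigl (mem (~: J))); last by move=> i; rewrite !inE.
rewrite big_split /= prodr_const -!rmorph_prod mulrAC -polyCM coefCM coefXn.
by rewrite eq_sym; case: eqP => _; rewrite ?mulr1 ?mulr0.
Qed.

Lemma esym_char_poly (R : realType) (n k : nat) (A : 'M[R]_n) (lam : 'rV[R]_n) :
  (k <= n)%N -> char_poly A = \prod_(i < n) ('X - (lam 0 i)%:P) ->
  esym_poly k lam = (-1) ^+ k * (char_poly A)`_(n - k).
Proof.
move=> kn ->.
rewrite (eq_bigr (fun i => 1%:P * 'X + (- lam 0 i)%:P)); last first.
  by move=> i _; rewrite mul1r polyCN.
rewrite (coef_prod_linear _ (fun=> 1)) /esym_poly mulr_sumr.
rewrite [RHS](reindex_inj (inv_inj (@finset.setCK _))) /=.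
have cE (J : {set 'I_n}) : (#|~: J| == n - k)%N = (#|J| == k).
  have := cardsC J; rewrite card_ord => cJ.
  by apply/eqP/eqP; lia.
apply: eq_big => [J|J /eqP cJ]; first by rewrite cE.
by rewrite finset.setCK big1_eq mul1r prodrN mulrA cJ -expr2 sqrr_sign mul1r.
Qed.

Lemma sum_sq_esym (R : realType) (n : nat) (lam : 'rV[R]_n) :
  (\sum_(i < n) lam 0 i) ^+ 2 =
  \sum_(i < n) lam 0 i ^+ 2 + esym_poly 2 lam *+ 2.
Proof.
rewrite expr2 mulr_suml; under eq_bigr do rewrite mulr_sumr.
rewrite pair_big /= (bigID (fun p => p.1 == p.2)) /=; congr (_ + _).
  rewrite (reindex (fun i : 'I_n => (i, i))) /=; last first.
    by exists fst => [i _|[i j]] //; rewrite inE /= => /eqP ->.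
  by apply: eq_big => [i|i _]; rewrite ?eqxx ?expr2.
(* Off-diagonal pairs are grouped by their underlying set; each class consists of [(a, b)] and
   [(b, a)]. *)
rewrite (partition_big (fun p => [set p.1; p.2]%SET)
  (fun A => #|A| == 2%N)) /=; last first.
  by move=> [i j] /= ij; rewrite cards2 ij.
rewrite /esym_poly -sumrMnl; apply: eq_bigr => A /cards2P [a [b [ab ->]]].
rewrite (bigD1 (a, b)) /=; last by rewrite ab eqxx.
rewrite (bigD1 (b, a)) /=; last first.
  by rewrite eq_sym ab finset.setUC eqxx /= xpair_eqE negb_and [b == a]eq_sym ab.
rewrite big1 ?addr0; last first.
  move=> [i j] /= /andP[/andP[/andP[ij /eqP/finset.setP S] n1] n2]; exfalso.
  have := S i; have := S j; rewrite !inE !eqxx ?orbT /= => hj hi.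
  move: n1 n2 ij; rewrite !xpair_eqE.
  case/esym/orP: hi => /eqP ->; case/esym/orP: hj => /eqP ->;
    by rewrite !eqxx ?andbF.
by rewrite big_setU1 ?inE //= big_set1 mulr2n [X in _ + X]mulrC.
Qed.

Lemma esym1 (R : realType) (n : nat) (lam : 'rV[R]_n.+1) :
  esym_poly 1 lam = \sum_i lam 0 i.
Proof.
rewrite /esym_poly.
rewrite (eq_bigl (fun J : {set 'I_n.+1} =>
    J \in [set [set i]%SET | i in [set: 'I_n.+1]%SET]%SET)).
  rewrite big_imset /=; last by move=> i j _ _; exact: set1_inj.
  by apply: eq_big => [i|i _]; rewrite ?inE ?big_set1.
move=> J; apply/cards1P/imsetP => [[i ->]|[i _ ->]]; first by exists i; rewrite ?inE.
by exists i.
Qed.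

Lemma trace_sum_roots (R : realType) (n : nat) (A : 'M[R]_n.+1)
  (lam : 'rV[R]_n.+1) :
  char_poly A = \prod_(i < n.+1) ('X - (lam 0 i)%:P) ->
  \tr A = \sum_i lam 0 i.
Proof.
move=> /(esym_char_poly (ltn0Sn n)); rewrite esym1 subn1 char_poly_trace //.
by rewrite expr1 mulN1r opprK.
Qed.

(** Factoring X^2 - A^2 as (X - A)(X + A) expresses the characteristic polynomial of A^2 at X^2
    through that of A at X and at -X, and composition with ['X^2] is injective. It yields the trace
    of A^2 as a sum of squared roots. *)
Lemma char_poly_sq (R : realType) (n : nat) (A : 'M[R]_n) (lam : 'rV[R]_n) :
  char_poly A = \prod_(i < n) ('X - (lam 0 i)%:P) ->
  char_poly (A *m A) = \prod_(i < n) ('X - (lam 0 i ^+ 2)%:P).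
Proof.
move=> cA.
have mapM (p : {poly R}) (B : 'M[R]_n) :
    map_mx (comp_poly p) (char_poly_mx B) = p%:M - map_mx polyC B.
  apply/matrixP => i j; rewrite !mxE rmorphB /= comp_polyC rmorphMn /=.
  by rewrite comp_polyX.
apply/eqP; rewrite -subr_eq0 -(@comp_poly_eq0 _ _ 'X^2) ?size_polyXn //.
rewrite rmorphB /= subr_eq0; apply/eqP.
rewrite -[LHS]det_map_mx /= mapM.
pose B := map_mx polyC A.
have -> : 'X^2%:M - map_mx polyC (A *m A) =
    char_poly_mx A *m (-1 *: map_mx (comp_poly (- 'X)) (char_poly_mx A)).
  rewrite mapM /char_poly_mx map_mxM /= -/B scaleN1r opprB raddfN opprK.
  rewrite mulmxBl !mulmxDr mul_mx_scalar mul_scalar_mx mul_mx_scalar.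
  rewrite scale_scalar_mx -expr2 opprD [- _ - _]addrC addrA.
  by rewrite [_ *: B + _]addrC addrK.
rewrite det_mulmx detZ det_map_mx -/(char_poly A) cA /=.
rewrite !rmorph_prod /= -[X in _ ^+ X]card_ord -prodr_const -!big_split /=.
apply: eq_bigr => i _; rewrite !rmorphB /= !comp_polyC comp_polyX rmorphXn /=.
by rewrite comp_polyX; ring.
Qed.

Lemma char_poly_conj (R : comNzRingType) (n : nat) (Q A : 'M[R]_n) :
  Q *m Q = 1%:M -> char_poly (Q *m A *m Q) = char_poly A.
Proof.
move=> QQ; rewrite /char_poly.
have qq : map_mx polyC Q *m map_mx polyC Q = 1%:M.
  by rewrite -map_mxM QQ map_scalar_mx.
have -> : char_poly_mx (Q *m A *m Q) =
    map_mx polyC Q *m char_poly_mx A *m map_mx polyC Q.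
  rewrite /char_poly_mx mulmxBr mulmxBl !map_mxM; congr (_ - _).
  by rewrite mul_mx_scalar -scalemxAl qq scalemx1.
by rewrite !det_mulmx mulrAC -det_mulmx qq det1 mul1r.
Qed.

(** Householder reflection in the hyperplane orthogonal to [g - enorm g *: delta_mx 0 0], or the
    identity when this vector is zero. *)
Lemma reflection_to_axis (R : realType) (n : nat) (g : 'rV[R]_n.+1) :
  exists Q : 'M[R]_n.+1, [/\ Q^T = Q, Q *m Q = 1%:M &
    g *m Q = enorm g *: delta_mx 0 0].
Proof.
pose e : 'rV[R]_n.+1 := enorm g *: delta_mx 0 0.
have dotE (x y : 'rV[R]_n.+1) : x *m y^T = (\sum_i x 0 i * y 0 i)%:M.
  apply/matrixP => i j; rewrite !mxE !ord1 eqxx.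
  by apply: eq_bigr => l _; rewrite mxE.
have N2 : enorm g ^+ 2 = \sum_i g 0 i ^+ 2.
  by rewrite sqr_sqrtr // sumr_ge0 // => i _; exact: sqr_ge0.
have e2 : \sum_i e 0 i ^+ 2 = \sum_i g 0 i ^+ 2.
  rewrite big_ord_recl big1 ?addr0 => [|i _]; rewrite !mxE ?eqxx ?mulr1 //.
  by rewrite mulr0 expr0n.
have [ge|ge] := eqVneq g e.
  exists 1%:M; rewrite tr_scalar_mx mulmx1; split => //.
  by rewrite mulmx1 {1}ge.
pose v := g - e; pose s := \sum_i v 0 i ^+ 2.
have s0 : s != 0.
  apply: contra_neq ge => s0; apply/eqP; rewrite -subr_eq0; apply/eqP/rowP => i.
  have : v 0 i ^+ 2 <= 0.
    by rewrite -s0 /s (bigD1 i) //= lerDl sumr_ge0 // => j _; exact: sqr_ge0.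
  rewrite le_eqVlt ltNge sqr_ge0 orbF sqrf_eq0 => /eqP vi.
  by rewrite [RHS]mxE.
(* Since [g] and [e] have the same length, twice the product of [g] and [v] is the squared length of
   [v]; hence the reflection sends [g] to [g - v = e]. *)
have gv : 2 * (\sum_i g 0 i * v 0 i) = s.
  apply/eqP; rewrite -subr_eq0 mulr_sumr -sumrB.
  rewrite (eq_bigr (fun i => g 0 i ^+ 2 - e 0 i ^+ 2)) ?sumrB ?e2 ?subrr //.
  move=> i _; have -> : v 0 i = g 0 i - e 0 i by rewrite !mxE.
  by ring.
exists (1%:M - (2 / s) *: (v^T *m v)); split.
- by rewrite linearB /= linearZ /= trmx_mul trmxK tr_scalar_mx.
- have WW : v^T *m v *m (v^T *m v) = s *: (v^T *m v).
    by rewrite mulmxA -[v^T *m v *m v^T]mulmxA dotE mul_mx_scalar -scalemxAl.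
  move: (v^T *m v) WW => W WW.
  rewrite mulmxBl !mulmxBr !mulmx1 !mul1mx -scalemxAl -!scalemxAr WW.
  rewrite !scalerA (_ : 2 / s * (2 / s) * s = 2 / s + 2 / s); last by field.
  by rewrite scalerDl opprB addrK subrK.
- rewrite mulmxBr mulmx1 -scalemxAr mulmxA dotE mul_scalar_mx scalerA.
  by rewrite mulrAC gv divff // scale1r /v subKr.
Qed.

(** In the Leibniz expansion a choice [J] of the factors X survives only if [s] fixes [J] pointwise.
    Then [s] permutes the complement, and the weights [d i * d (s i)] multiply to the product of the
    [d i ^+ 2], independently of [s]. *)
Lemma char_poly_coef_le (R : realFieldType) (n m : nat) (A : 'M[R]_n)
  (d : 'I_n -> R) :
  (forall i, 0 <= d i) -> (forall i j, `|A i j| <= d i * d j) ->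
  `|(char_poly A)`_m| <=
  n`!%:R * \sum_(J : {set 'I_n} | #|J| == m) \prod_(i in ~: J) d i ^+ 2.
Proof.
move=> d0 Ad; rewrite /char_poly coef_sum.
rewrite [leRHS](_ : _ =
    \sum_(s : 'S_n)
      \sum_(J : {set 'I_n} | #|J| == m) \prod_(i in ~: J) d i ^+ 2); last first.
  by rewrite sumr_const -cardsE cardsT card_Sn mulr_natl.
apply: le_trans (ler_norm_sum _ _ _) _; apply: ler_sum => s _.
rewrite -(rmorph_sign polyC) /= coefCM normrM normr_sign mul1r.
under eq_bigr => i _.
  have -> : char_poly_mx A i (s i) =
      ((i == s i)%:R)%:P * 'X + (- A i (s i))%:P.
    rewrite !mxE polyCN rmorph_nat mulr_natl; by case: eqP.
  over.
rewrite coef_prod_linear; apply: le_trans (ler_norm_sum _ _ _) _.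
apply: ler_sum => J _; rewrite normrM.
have [/forall_inP fixJ|nfix] := boolP [forall i in J, i == s i]; last first.
  move: nfix; rewrite negb_forall => /existsP[i]; rewrite negb_imply => /andP[iJ].
  move=> /negbTE si; rewrite (bigD1 i iJ) /= si mul0r normr0 mul0r.
  by rewrite prodr_ge0 // => l _; rewrite sqr_ge0.
rewrite big1 ?normr1 ?mul1r; last by move=> i /fixJ ->.
rewrite normr_prod.
have -> : \prod_(i in ~: J) d i ^+ 2 = \prod_(i in ~: J) (d i * d (s i)).
  under eq_bigr do rewrite expr2.
  rewrite !big_split /=; congr (_ * _).
  rewrite [LHS](reindex_inj (@perm_inj _ s)) /=; apply: eq_bigl => i.
  rewrite !inE; congr (~~ _); apply/idP/idP => [siJ|iJ].
    by have /eqP/perm_inj -> := fixJ _ siJ.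
  by rewrite -(eqP (fixJ _ iJ)).
by apply: ler_prod => i _; rewrite normr_ge0 normrN Ad.
Qed.

Lemma quad_delta (R : comNzRingType) (n : nat) (A : 'M[R]_n) (i j : 'I_n) :
  ((delta_mx 0 i : 'rV_n) *m A *m (delta_mx 0 j : 'rV_n)^T) 0 0 = A i j.
Proof. by rewrite -rowE trmx_delta -colE !mxE. Qed.

(* [tr (A^2) < (tr A)^2] says that the second elementary symmetric function is
   positive. It forces the trace of the block of [A] away from index 0 to be
   positive, so the upper bounds on the diagonal also bound it from below. *)
Lemma gamma2_entries (R : realType) (n : nat) (A : 'M[R]_n.+1) (b c : R)
  (w := fun i : 'I_n.+1 => Num.sqrt (if i == 0 then b + c else b)) :
  A^T = A -> 0 < b -> 0 <= c ->
  (forall y : 'rV[R]_n.+1, (y *m A *m y^T) 0 0 <=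
     b * (y *m y^T) 0 0 + c * y 0 0 ^+ 2) ->
  0 < \tr A -> \tr (A *m A) < (\tr A) ^+ 2 ->
  forall i j, `|A i j| <= n.+1%:R * (w i * w j).
Proof.
move=> symA b0 c0 Aq tr0 tr2.
have Aij i j : A j i = A i j by rewrite -[in LHS]symA mxE.
have wii i : w i * w i = if i == 0 then b + c else b.
  rewrite -expr2 sqr_sqrtr //; case: eqP => _; lra.
have dd (i : 'I_n.+1) :
    ((delta_mx 0 i : 'rV[R]_n.+1) *m (delta_mx 0 i : 'rV[R]_n.+1)^T) 0 0 = 1.
  by rewrite trmx_delta mul_delta_mx mxE !eqxx.
have dg i : A i i <= w i * w i.
  have := Aq (delta_mx 0 i); rewrite quad_delta dd wii mxE eqxx /= eq_sym.
  by case: (i == 0) => /=; rewrite ?expr1n ?expr0n /=; lra.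
pose T' := \sum_(i < n) A (lift ord0 i) (lift ord0 i).
have trE : \tr A = A 0 0 + T' by rewrite /mxtrace big_ord_recl.
(* By symmetry the trace of [A *m A] is the sum of all squared entries; only the entries [(i, j)]
   and [(0, 0)] are kept. *)
have frob i j : i != j -> A i j ^+ 2 <= (\tr A) ^+ 2 - A 0 0 ^+ 2.
  move=> ij; rewrite lerBrDr; apply: le_trans (ltW tr2).
  rewrite /mxtrace; under eq_bigr do rewrite mxE.
  rewrite pair_big /= (bigD1 (i, j)) //= (bigD1 (0, 0)) /=; last first.
    by rewrite xpair_eqE; apply: contra ij => /andP[/eqP<- /eqP<-].
  rewrite Aij -!expr2 lerD2l lerDl sumr_ge0 // => p _.
  by rewrite Aij -expr2 sqr_ge0.
have frob00 : A 0 0 ^+ 2 < (\tr A) ^+ 2.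
  apply: le_lt_trans tr2; rewrite /mxtrace; under eq_bigr do rewrite mxE.
  rewrite pair_big /= (bigD1 (0, 0)) //= -expr2 lerDl sumr_ge0 // => p _.
  by rewrite Aij -expr2 sqr_ge0.
(* If [T' <= 0], then [0 < \tr A <= A 0 0], against [frob00]. *)
have T'0 : 0 < T' by rewrite trE in frob00 tr0; nra.
have dgl (i : 'I_n) : A (lift ord0 i) (lift ord0 i) <= b.
  by have := dg (lift ord0 i); rewrite wii.
have T'n : T' <= n%:R * b.
  rewrite mulr_natl -[X in _ *+ X]card_ord -sumr_const.
  by apply: ler_sum => i _.
have dgg (i : 'I_n) : - (n%:R * b) <= A (lift ord0 i) (lift ord0 i).
  have : T' - A (lift ord0 i) (lift ord0 i) <= n%:R * b.
    rewrite /T' (bigD1 i) //= addrAC subrr add0r mulr_natl.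
    rewrite -[X in _ *+ X]card_ord -sumr_const [leRHS](bigD1 i) //=.
    by rewrite ler_wpDl ?(ltW b0) //; apply: ler_sum => j _.
  lra.
have nS : n.+1%:R = n%:R + 1 :> R by rewrite -natr1.
have n0 : 0 <= n%:R :> R by [].
have diag i : `|A i i| <= n.+1%:R * (w i * w i).
  rewrite wii; case: (unliftP ord0 i) => [j ->|->].
    by rewrite /= ler_norml nS; have := dgl j; have := dgg j; lra.
  rewrite eqxx ler_norml nS; have := dg 0; rewrite wii eqxx => d0.
  by rewrite trE in tr0; apply/andP; split; nra.
have off0 i : i != 0 -> `|A 0 i| <= n.+1%:R * (w 0 * w i).
  move=> i0; have := frob 0 i; rewrite eq_sym i0 => /(_ isT) h.
  have bc0 : 0 <= b + c by lra.
  rewrite -ler_sqr ?nnegrE ?mulr_ge0 ?sqrtr_ge0 ?addr_ge0 //.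
  rewrite real_normK ?num_real //; apply: le_trans h _.
  rewrite !exprMn /w eqxx (negbTE i0) !sqr_sqrtr ?(ltW b0) // trE nS.
  have := dg 0; rewrite wii eqxx => d0.
  (* The factor [T' <= n b] is the gain: the squared entry is of order [b * (b + c)], not
     [(b + c) ^+ 2]. *)
  have -> : (A 0 0 + T') ^+ 2 - A 0 0 ^+ 2 = T' * (2 * A 0 0 + T') by ring.
  have : T' * (2 * A 0 0 + T') <= T' * ((n%:R + 2) * (b + c)).
    by rewrite ler_pM2l //; nra.
  have : T' * ((n%:R + 2) * (b + c)) <= n%:R * b * ((n%:R + 2) * (b + c)).
    by rewrite ler_wpM2r // mulr_ge0 //; lra.
  have : 0 <= b * (b + c) by rewrite mulr_ge0 // ltW.
  by rewrite trE in tr0; nra.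
have offd (i j : 'I_n) : i != j ->
    `|A (lift ord0 i) (lift ord0 j)| <= n.+1%:R * b.
  move=> ij; set I := lift ord0 i; set J := lift ord0 j.
  have IJ : I != J by apply: contra ij => /eqP /lift_inj ->.
  have half e : e ^+ 2 = 1 -> e * A I J *+ 2 <= b *+ 2 - A I I - A J J.
    (* Polarization with both signs of [e]; coordinate 0 of [y] vanishes, so [c] does not enter. *)
    move=> e1; pose y : 'rV[R]_n.+1 := delta_mx 0 I + e *: delta_mx 0 J.
    have addE (M N : 'M[R]_1) : (M + N) 0 0 = M 0 0 + N 0 0 by rewrite mxE.
    have scaleE x (M : 'M[R]_1) : (x *: M) 0 0 = x * M 0 0 by rewrite mxE.
    have yE (B : 'M[R]_n.+1) : B^T = B ->
        (y *m B *m y^T) 0 0 = B I I + B J J + e * B I J *+ 2.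
      move=> symB; have BJI : B J I = B I J by rewrite -[in LHS]symB mxE.
      rewrite /y !mulmxDl linearD /= !mulmxDr linearZ /= -?scalemxAl -?scalemxAr.
      rewrite -?scalemxAl !addE !scaleE !quad_delta BJI.
      by rewrite [e * (e * _)]mulrA -[e * e]expr2 e1; ring.
    have yy := yE _ (tr_scalar_mx _ 1); rewrite mulmx1 in yy.
    have := Aq y; rewrite yE // yy.
    have -> : y 0 0 = 0 by rewrite /y !mxE /= mulr0 addr0.
    by rewrite !mxE !eqxx (negbTE IJ) /= expr0n /= !mulr0 ?mulr0n; lra.
  have := half 1; have := half (-1); rewrite sqrrN expr1n.
  move=> /(_ erefl) h1 /(_ erefl) h2; rewrite ler_norml nS.
  have := dgg i; have := dgg j; rewrite -/I -/J => h3 h4.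
  by apply/andP; split; lra.
move=> i j; have [<-|ij] := eqVneq i j; first exact: diag.
case: (unliftP ord0 i) => [i' ii|i0]; last first.
  by rewrite i0; apply: off0; rewrite eq_sym -[0]i0.
case: (unliftP ord0 j) => [j' jj|j0]; last first.
  by rewrite j0 -Aij [w i * _]mulrC; apply: off0; rewrite -[0]j0.
rewrite ii jj (_ : w _ * w _ = b); last first.
  by rewrite /w /= -expr2 sqr_sqrtr // ltW.
by apply: offd; apply: contra ij; rewrite ii jj => /eqP ->.
Qed.

(** The default list 0 has vanishing first symmetric function, hence lies outside [Gamma k];
    admissibility therefore guarantees genuine eigenvalues. *)
Lemma eigenvalues_char_poly (R : realType) (n k : nat) (A : 'M[R]_n) :
  (0 < k)%N -> Gamma k (eigenvalues A) ->
  char_poly A = \prod_(i < n) ('X - (eigenvalues A 0 i)%:P).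
Proof.
move=> k0 gA; rewrite /eigenvalues; case: xgetP => [lam _ //|noeig].
have : 0 < esym_poly 1 (eigenvalues A) by apply: gA; rewrite k0.
rewrite /eigenvalues xgetPN //= /esym_poly big1 ?ltxx // => B /cards1P[i ->].
by rewrite big_set1 mxE.
Qed.

(* After a reflection taking [g] to the first axis, the entries of [A] satisfy
   [|A i j| <= C w_i w_j] with [w_0^2 = b + c] and [w_i^2 = b] otherwise, and the
   Leibniz expansion of the characteristic polynomial bounds [S_mx k A]. *)
Lemma S_mx_le (R : realType) (n k : nat) : (0 < k <= n.+1)%N ->
  exists2 K : R, 0 < K &
  forall (A : 'M[R]_n.+1) (g : 'rV[R]_n.+1) (b c : R),
    A^T = A -> 0 < b -> 0 <= c -> enorm g <= 1 ->
    (forall y : 'rV[R]_n.+1, (y *m A *m y^T) 0 0 <=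
      b * (y *m y^T) 0 0 + c * (y *m g^T) 0 0 ^+ 2) ->
    Gamma k (eigenvalues A) ->
    S_mx k A <= K * ((b + c) * b ^+ k.-1).
Proof.
move=> /andP[k0 kn].
pose N := #|[pred J : {set 'I_n.+1} | #|J| == n.+1 - k]|%N.
(* The first summand serves k >= 2: permutations, choices of [J], and one factor n+1 for each of the
   k entries. The second serves k = 1. *)
exists ((n.+1)`!%:R * (N%:R * n.+1%:R ^+ k) + n.+1%:R).
  by rewrite ltr_wpDl // !mulr_ge0 // exprn_ge0.
move=> A g b c symA b0 c0 g1 Aq gA.
have cA := eigenvalues_char_poly k0 gA.
have [Q [symQ QQ gQ]] := reflection_to_axis g.
pose B := Q *m A *m Q.
have cB : char_poly B = \prod_(i < n.+1) ('X - (eigenvalues A 0 i)%:P).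
  by rewrite char_poly_conj.
have symB : B^T = B by rewrite /B !trmx_mul symQ symA mulmxA.
have Bq (y : 'rV[R]_n.+1) :
    (y *m B *m y^T) 0 0 <= b * (y *m y^T) 0 0 + c * y 0 0 ^+ 2.
  have := Aq (y *m Q); rewrite trmx_mul symQ !mulmxA.
  rewrite -[y *m Q *m Q]mulmxA QQ mulmx1 -[y *m Q *m g^T]mulmxA.
  have -> : Q *m g^T = enorm g *: (delta_mx 0 0 : 'rV[R]_n.+1)^T.
    by rewrite -[LHS]trmxK trmx_mul trmxK symQ gQ linearZ.
  have -> : (y *m (enorm g *: (delta_mx 0 0 : 'rV[R]_n.+1)^T)) 0 0 =
      enorm g * y 0 0 by rewrite -scalemxAr trmx_delta -colE !mxE.
  move=> h; apply: le_trans h _; rewrite lerD2l exprMn.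
  rewrite ler_wpM2l // ler_piMl ?sqr_ge0 // expr_le1 //.
  exact: sqrtr_ge0.
have bc : b <= b + c by rewrite lerDl.
have BC0 : 0 <= (b + c) * b ^+ k.-1.
  by rewrite mulr_ge0 ?exprn_ge0 // ltW // (lt_le_trans b0).
have k1 : k = k.-1.+1 by rewrite prednK.
(* For k = 1 there is no information on S_2, but the trace is controlled by the diagonal alone. *)
rewrite /S_mx; have [k2|k2] := leqP k 1.
  have -> : k = 1%N by lia.
  rewrite esym1 -(trace_sum_roots cB) expr0 mulr1.
  apply: (@le_trans _ _ (n.+1%:R * (b + c))).
    rewrite mulr_natl -[X in _ *+ X]card_ord -sumr_const.
    apply: ler_sum => i _; have := Bq (delta_mx 0 i); rewrite quad_delta.
    rewrite trmx_delta mul_delta_mx !mxE !eqxx /= mulr1 => h.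
    apply: le_trans h _; rewrite lerD2l.
    by case: eqP => _ /=; rewrite ?expr1n ?expr0n /=; lra.
  rewrite ler_wpM2r //; first lra.
  by rewrite lerDr !mulr_ge0 // exprn_ge0.
have s1 : 0 < \tr B.
  by rewrite (trace_sum_roots cB) -esym1; apply: gA; lia.
have s2 : \tr (B *m B) < (\tr B) ^+ 2.
  have := char_poly_sq cB.
  rewrite (eq_bigr (fun i => 'X - ((\row_j (eigenvalues A 0 j ^+ 2)) 0 i)%:P)).
    move=> /trace_sum_roots ->; rewrite (trace_sum_roots cB) sum_sq_esym.
    under eq_bigr do rewrite mxE.
    by rewrite ltrDl pmulrn_lgt0 //; apply: gA; lia.
  by move=> i _; rewrite mxE.
have Bij := gamma2_entries symB b0 c0 Bq s1 s2.
set w := fun i : 'I_n.+1 => Num.sqrt (if i == 0 then b + c else b) in Bij.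
pose d i := Num.sqrt n.+1%:R * w i.
have d0 i : 0 <= d i by rewrite mulr_ge0 ?sqrtr_ge0.
have Bd i j : `|B i j| <= d i * d j.
  apply: le_trans (Bij i j) _; rewrite /d mulrACA -expr2 sqr_sqrtr //.
have d2 i : d i ^+ 2 = n.+1%:R * (if i == 0 then b + c else b).
  rewrite exprMn !sqr_sqrtr //; case: eqP => _; lra.
rewrite (esym_char_poly kn cB); apply: le_trans (ler_norm _) _.
rewrite normrM normrX normrN1 expr1n mul1r.
apply: le_trans (char_poly_coef_le (n.+1 - k) d0 Bd) _.
rewrite mulrDl -[leLHS]addr0; apply: lerD; last by rewrite mulr_ge0.
rewrite -!mulrA ler_wpM2l // mulrA.
rewrite -mulrA [leRHS]mulr_natl -sumr_const; apply: ler_sum => J /eqP cJ.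
have {}cJ : #|~: J|%N = k by have := cardsC J; rewrite card_ord; lia.
under eq_bigr do rewrite d2.
rewrite big_split /= prodr_const cJ ler_wpM2l ?exprn_ge0 //.
(* Index 0 occurs at most once in the product, so at most one factor is [b + c]. *)
have [J0|J0] := boolP (0 \in ~: J).
  rewrite (bigD1 0) //= ler_wpM2l //; first lra.
  rewrite (eq_bigr (fun=> b)); last by move=> i /andP[_ /negbTE ->].
  rewrite prodr_const (_ : #|_| = k.-1) //.
  rewrite -cJ (cardsD1 0 (~: J)) J0 /=; apply: eq_card => i.
  by rewrite in_setD1 unfold_in andbC.
rewrite (eq_bigr (fun=> b)); last first.
  by move=> i iJ; case: eqP => // i0; rewrite i0 (negbTE J0) in iJ.
by rewrite prodr_const cJ k1 exprS ler_wpM2r ?exprn_ge0 // ltW.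
Qed.

Lemma esym_eigenvalues (R : realType) (n p : nat) (A : 'M[R]_n)
  (lam : 'rV[R]_n) : (p <= n)%N ->
  char_poly A = \prod_(i < n) ('X - (lam 0 i)%:P) ->
  esym_poly p (eigenvalues A) = esym_poly p lam.
Proof.
move=> pn cA; have cE : char_poly A = \prod_(i < n) ('X - (eigenvalues A 0 i)%:P).
  by rewrite /eigenvalues; case: xgetP => [mu _ //|/(_ lam)].
by rewrite (esym_char_poly pn cA) (esym_char_poly pn cE).
Qed.

(** This is the shape of the augmented Hessian of a radial function; the reflection taking [x] to
    the first axis makes it diagonal. *)
Lemma char_poly_rank_one (R : realType) (n : nat) (a b : R)
  (x : 'rV[R]_n.+1) :
  char_poly (a%:M + b *: (x^T *m x)) = \prod_(i < n.+1)
    ('X - ((\row_j (if j == 0 then a + b * enorm x ^+ 2 else a)) 0 i)%:P).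
Proof.
have [Q [symQ QQ xQ]] := reflection_to_axis x.
rewrite -(char_poly_conj _ QQ).
have -> : Q *m (a%:M + b *: (x^T *m x)) *m Q =
    a%:M + (b * enorm x ^+ 2) *: delta_mx 0 0.
  rewrite mulmxDr mulmxDl mul_mx_scalar -scalemxAl QQ scalemx1.
  rewrite -scalemxAr -scalemxAl.
  rewrite (_ : Q *m (x^T *m x) *m Q = Q *m x^T *m (x *m Q)); last by rewrite !mulmxA.
  rewrite xQ.
  rewrite (_ : Q *m x^T = enorm x *: delta_mx 0 0).
    by rewrite -scalemxAl -scalemxAr mul_delta_mx !scalerA expr2 mulrA.
  by rewrite -[LHS]trmxK trmx_mul trmxK symQ xQ linearZ /= trmx_delta.
rewrite char_poly_trig; last first.
  apply/is_trig_mxP => i j ij; rewrite !mxE -!val_eqE /= (ltn_eqF ij).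
  by case: eqP => [i0|_]; case: eqP => [j0|_] /=; rewrite ?mulr0 ?addr0 //; lia.
apply: eq_bigr => i _; rewrite !mxE eqxx mulr1n andbb.
by case: eqP => _ /=; rewrite ?mulr1 ?mulr0 ?addr0.
Qed.

(** All roots are positive, so each symmetric function is at least any single one of its products.
    The product over the first k indices contains the large root, which sits at index 0. *)
Lemma Gamma_rank_one (R : realType) (n k : nat) (a b : R) (x : 'rV[R]_n.+1) :
  (0 < k <= n.+1)%N -> 0 < a -> 0 <= b ->
  Gamma k (eigenvalues (a%:M + b *: (x^T *m x))) /\
  (a + b * enorm x ^+ 2) * a ^+ k.-1 <= S_mx k (a%:M + b *: (x^T *m x)).
Proof.
move=> /andP[k0 kn] a0 b0.
pose lam : 'rV[R]_n.+1 := \row_j (if j == 0 then a + b * enorm x ^+ 2 else a).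
have ab : 0 < a + b * enorm x ^+ 2 by rewrite ltr_wpDr // mulr_ge0 ?sqr_ge0.
have lam0 i : 0 < lam 0 i by rewrite mxE; case: eqP.
have esymE p : (p <= n.+1)%N -> esym_poly p (eigenvalues (a%:M + b *: (x^T *m x))) =
    esym_poly p lam.
  by move=> pn; rewrite (esym_eigenvalues pn (char_poly_rank_one _ _ _)).
pose J p : {set 'I_n.+1} := [set i : 'I_n.+1 | (i < p)%N]%SET.
have cJ p : (p <= n.+1)%N -> #|J p|%N = p.
  move=> pn; rewrite cardsE -sum1_card -(big_ord_widen _ (fun=> 1%N)) //.
  by rewrite sum1_card card_ord.
have lb p : (p <= n.+1)%N -> \prod_(i in J p) lam 0 i <= esym_poly p lam.
  move=> pn; rewrite /esym_poly (bigD1 (J p)) ?cJ //= lerDl sumr_ge0 // => S _.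
  by apply: prodr_ge0 => i _; exact: ltW.
split=> [p /andP[p0 pk]|].
  rewrite esymE ?(leq_trans pk) //; apply: lt_le_trans (lb p _).
    exact: prodr_gt0.
  exact: leq_trans kn.
rewrite /S_mx esymE //; apply: le_trans (lb k kn).
have J0 : 0 \in J k by rewrite inE.
rewrite (bigD1 0) //= !mxE eqxx.
rewrite (eq_bigr (fun=> a)); last by move=> i /andP[_ /negbTE i0]; rewrite mxE i0.
rewrite prodr_const (_ : #|_| = k.-1) //.
rewrite -[in RHS](cJ k kn) (cardsD1 0 (J k)) J0 /=; apply: eq_card => i.
by rewrite in_setD1 unfold_in andbC.
Qed.

(** Serves k = 1, where a negative [mu] may make [a] negative and only the trace matters. *)
Lemma esym1_rank_one (R : realType) (n : nat) (a b : R) (x : 'rV[R]_n.+1) :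
  esym_poly 1 (eigenvalues (a%:M + b *: (x^T *m x))) =
  n.+1%:R * a + b * enorm x ^+ 2.
Proof.
rewrite (esym_eigenvalues _ (char_poly_rank_one _ _ _)) // esym1 big_ord_recl.
rewrite mxE eqxx (eq_bigr (fun=> a)) => [|i _]; last by rewrite mxE.
by rewrite sumr_const card_ord -[a *+ n]mulr_natl -natr1; ring.
Qed.

(** * Second-order calculus on row vectors *)

Lemma is_derive_cvg (R : realType) (V : normedModType R) (f : V -> R)
  (x v : V) (d : R) :
  is_derive x v f d <-> h^-1 *: (f (h *: v + x) - f x) @[h --> 0^'] --> d.
Proof.
split=> [[df <-] //|fd]; split; first exact: cvgP fd.
exact: cvg_lim fd.
Qed.

Lemma is_derive_line (R : realType) (V : normedModType R) (f : V -> R)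
  (z w : V) (t d : R) :
  is_derive t 1 (fun s => f (z + s *: w)) d <-> is_derive (z + t *: w) w f d.
Proof.
rewrite !is_derive_cvg /=; set g1 := fun h => _; set g2 := fun h => _.
suff -> : g1 = g2 by [].
apply/funext => h; rewrite /g1 /g2; congr (_ *: (f _ - _)).
by rewrite scalerDl addrCA [_%:A]mulr1.
Qed.

(** Locating [c] by its distance to [a] treats increments of both signs at once. *)
Lemma mean_value (R : realType) (g g1 : R -> R) (a b : R) :
  (forall t : R, is_derive t 1 g (g1 t)) ->
  exists2 c, `|c - a| <= `|b - a| & g b - g a = g1 c * (b - a).
Proof.
move=> dg.
have cg : continuous g.
  by move=> t; apply/differentiable_continuous/derivable1_diffP; case: (dg t).
have [ab|/ltW ba] := leP a b.
  have [c] := MVT_segment ab (fun t _ => dg t) (continuous_subspaceT cg).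
  rewrite in_itv /= => /andP[ac cb] ->; exists c => //.
  by rewrite !ger0_norm ?subr_ge0 // lerB.
have [c] := MVT_segment ba (fun t _ => dg t) (continuous_subspaceT cg).
rewrite in_itv /= => /andP[bc ca] E; exists c; last first.
  by rewrite -opprB E -mulrN opprB.
by rewrite !ler0_norm ?subr_le0 // lerN2 lerB.
Qed.

(* Directional derivatives are assembled one coordinate at a time, which avoids
   Frechet differentiability of C^1 functions. *)
Lemma is_derive_add_dir (R : realType) (V : normedModType R) (f e : V -> R)
  (x v w : V) (c d : R) :
  is_derive x v f d -> (forall z, is_derive z w f (e z)) ->
  {for x, continuous e} -> is_derive x (v + c *: w) f (d + c * e x).
Proof.
move=> /is_derive_cvg fv fw ce; apply/is_derive_cvg.
(* Mean value theorem along [w], starting from the point already displaced by [h *: v]. *)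
have E h : exists2 s, `|s| <= `|h * c| &
    f (h *: (v + c *: w) + x) - f (h *: v + x) = e (h *: v + x + s *: w) * (h * c).
  have dl (t : R) : is_derive t 1 (fun s => f (h *: v + x + s *: w))
      (e (h *: v + x + t *: w)) by apply/is_derive_line.
  have [s sle] := mean_value 0 (h * c) dl.
  rewrite !subr0 scale0r addr0 in sle * => eE; exists s => //; rewrite -eE.
  by rewrite scalerDr scalerA addrAC.
have -> : (fun h => h^-1 *: (f (h *: (v + c *: w) + x) - f x)) =
  (fun h => h^-1 *: (f (h *: v + x) - f x) +
            h^-1 *: (f (h *: (v + c *: w) + x) - f (h *: v + x))).
  by apply/funext => h; rewrite -scalerDr; congr (_ *: _); ring.
apply: cvgD => //; apply/cvgrPdist_lt => eps eps0.
have c1 : 0 < `|c| + 1 by rewrite ltr_wpDl.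
have /cvgrPdist_lt/(_ (eps / (`|c| + 1)) (divr_gt0 eps0 c1)) := ce.
move=> /nbhs_normP[del /= del0 Hd].
have N0 : 0 < `|v| + `|c| * `|w| + 1 by rewrite ltr_wpDl // addr_ge0 // mulr_ge0.
near=> h.
have h0 : h != 0 by near: h; exact: nbhs_dnbhs_neq.
have [s sle ->] := E h.
have -> : h^-1 *: (e (h *: v + x + s *: w) * (h * c)) = e (h *: v + x + s *: w) * c.
  by rewrite [LHS]mulrC; field.
rewrite mulrC -mulrBl normrM.
have : `|e x - e (h *: v + x + s *: w)| < eps / (`|c| + 1).
  apply: Hd => /=; rewrite (addrAC (h *: v)) [x - _]addrC opprD subrK normrN.
  apply: le_lt_trans (ler_normD _ _) _; rewrite !normrZ.
  have hN : `|h| < del / (`|v| + `|c| * `|w| + 1).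
    by near: h; apply: dnbhs0_lt; rewrite divr_gt0.
  rewrite ltr_pdivlMr // in hN; apply: le_lt_trans hN.
  rewrite normrM in sle; rewrite mulrDr mulrDr mulr1 -addrA lerD2l.
  by rewrite ler_wpDr // mulrA ler_wpM2r.
move=> lt; rewrite -[eps](divfK (lt0r_neq0 c1)).
apply: (@le_lt_trans _ _ (`|e x - e (h *: v + x + s *: w)| * (`|c| + 1))).
  by rewrite ler_wpM2l // lerDl.
by rewrite ltr_pM2r.
Unshelve. all: by end_near.
Qed.

Lemma C1_is_derive (R : realType) (n : nat) (u : 'rV[R]_n -> R) (x y : 'rV[R]_n) :
  C1 u -> is_derive x y u (\sum_(i < n) y 0 i * partial i u x).
Proof.
move=> [_ du]; rewrite {1}[y]row_sum_delta.
elim/big_rec2: _ => [|i d v _ IH]; first exact: is_derive0.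
rewrite addrC [y 0 i * _ + _]addrC; apply: is_derive_add_dir IH _ _.
  by move=> z; apply: DeriveDef => //; exact: (du i).1.
exact: (du i).2.
Qed.

(** Were [m] positive, [g1] would be positive just to the right of 0, and [g] would exceed [g 0]
    there. *)
Lemma second_derivative_max (R : realType) (g g1 : R -> R) (m : R) :
  (forall t : R, is_derive t 1 g (g1 t)) -> is_derive (0 : R) 1 g1 m ->
  (forall t, g t <= g 0) -> g1 0 = 0 /\ m <= 0.
Proof.
move=> dg dm gmax.
have g10 : g1 0 = 0.
  have [_ <-] := dg 0.
  have h : is_derive (0 : R) 1 g 0.
    apply: (@derive1_at_max _ g (-1) 1) => [|t _||t _].
    - by lra.
    - by case: (dg t).
    - by rewrite in_itv /= ltrN10 ltr01.
    - exact: gmax.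
  by case: h.
split=> //; rewrite leNgt; apply/negP => m0.
move/is_derive_cvg : dm; rewrite g10 => /cvgrPdist_lt /(_ _ m0).
move=> /nbhs_normP[del /= del0 Hd].
have d2 : 0 < del / 2 by rewrite divr_gt0.
have cg : continuous g.
  by move=> t; apply/differentiable_continuous/derivable1_diffP; case: (dg t).
have [c] := MVT d2 (fun t _ => dg t) (continuous_subspaceT cg).
rewrite in_itv /= subr0 => /andP[c0 cd] E.
have : 0 < g1 c.
  have c0' : c != 0 by rewrite gt_eqF.
  have := Hd c; rewrite /= sub0r normrN gtr0_norm // => /(_ _ c0').
  rewrite [_ + 0]addr0 [_ *: 1]mulr1 subr0 => h.
  have /h : c < del by apply: lt_le_trans cd _; lra.
  rewrite ltr_norml => /andP[_]; rewrite ltrBlDr ltrDl.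
  by rewrite /GRing.scale /= pmulr_rgt0 // invr_gt0.
move=> g1c; have := gmax (del / 2); rewrite leNgt => /negP; apply.
by rewrite -subr_gt0 E mulr_gt0.
Qed.

Lemma mixed_difference (R : realType) (n : nat) (u : 'rV[R]_n -> R) (i j : 'I_n)
  (x : 'rV[R]_n) (h : R) :
  C2 u -> exists s t : R, [/\ `|s| <= `|h|, `|t| <= `|h| &
    u (x + h *: delta_mx 0 i + h *: delta_mx 0 j) - u (x + h *: delta_mx 0 i)
    - (u (x + h *: delta_mx 0 j) - u x) =
    partial j (partial i u) (x + s *: delta_mx 0 i + t *: delta_mx 0 j) * h * h].
Proof.
move=> [[_ du] ddu]; set ei := delta_mx 0 i; set ej := delta_mx 0 j.
have dl (z : 'rV[R]_n) (s : R) :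
    is_derive s 1 (fun r => u (z + r *: ei)) (partial i u (z + s *: ei)).
  by apply/is_derive_line; apply: DeriveDef => //; exact: (du i).1.
have dd (z : 'rV[R]_n) (s : R) :
    is_derive s 1 (fun r => partial i u (z + r *: ej))
      (partial j (partial i u) (z + s *: ej)).
  by apply/is_derive_line; apply: DeriveDef => //; exact: ((ddu i).2 j).1.
have dg (s : R) : is_derive s 1
    (fun r => u (x + h *: ej + r *: ei) - u (x + r *: ei))
    (partial i u (x + h *: ej + s *: ei) - partial i u (x + s *: ei)).
  exact: is_deriveB.
have [s sh E] := mean_value 0 h dg.
have [t th F] := mean_value 0 h (dd (x + s *: ei)).
rewrite !subr0 !scale0r !addr0 in sh th E F; exists s, t; split=> //.
rewrite -F [x + s *: ei + _]addrAC -E -[x + h *: ei + _]addrAC; ring.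
Qed.

Lemma dist_halves_absurd (R : realFieldType) (X Y Z : R) :
  `|Y - Z| < `|X - Y| / 2 -> `|X - Z| < `|X - Y| / 2 -> False.
Proof.
move=> h1 h2; have := ler_distD Z X Y; rewrite leNgt => /negP; apply.
by rewrite [ltRHS]splitr ltrD // distrC.
Qed.

(** Schwarz's theorem: the second difference is unchanged when [i] and [j] are exchanged and equals
    [h ^ 2] times either mixed partial derivative at some nearby point, so continuity rules out a
    gap between the two. *)
Lemma hessian_symmetric (R : realType) (n : nat) (u : 'rV[R]_n -> R) (i j : 'I_n)
  (x : 'rV[R]_n) :
  C2 u -> partial j (partial i u) x = partial i (partial j u) x.
Proof.
move=> C2u.
have half a b eps : 0 < eps -> exists2 del : R, 0 < del &
    forall s t : R, `|s| < del -> `|t| < del ->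
    `|partial b (partial a u) x -
      partial b (partial a u) (x + s *: delta_mx 0 a + t *: delta_mx 0 b)| < eps.
  move=> eps0.
  have /cvgrPdist_lt/(_ _ eps0) := ((C2u.2 a).2 b).2 x.
  move=> /nbhs_normP[del /= del0 Hd].
  pose N := `|delta_mx 0 a : 'rV[R]_n| + `|delta_mx 0 b : 'rV[R]_n| + 1.
  have N0 : 0 < N by rewrite ltr_wpDl // addr_ge0.
  exists (del / N); first by rewrite divr_gt0.
  move=> s t; rewrite !ltr_pdivlMr // => sd td; apply: Hd => /=.
  rewrite -addrA opprD addrA subrr sub0r normrN.
  apply: le_lt_trans (ler_normD _ _) _; rewrite !normrZ.
  have := normr_ge0 (delta_mx 0 a : 'rV[R]_n).
  have := normr_ge0 (delta_mx 0 b : 'rV[R]_n); rewrite /N in sd td.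
  set A := `|delta_mx 0 a| in sd td *; set B := `|delta_mx 0 b| in sd td *.
  have [st|ts] := leP `|s| `|t|.
    by have := normr_ge0 t; nra.
  by have := normr_ge0 s; nra.
apply/eqP; rewrite -subr_eq0 -normr_le0 leNgt; apply/negP => d0.
have e0 : 0 < `|partial j (partial i u) x - partial i (partial j u) x| / 2.
  by rewrite divr_gt0.
have [d1 d10 H1] := half i j _ e0; have [d2 d20 H2] := half j i _ e0.
pose h := Num.min d1 d2 / 2.
have m0 : 0 < Num.min d1 d2 by rewrite lt_min d10.
have h0 : 0 < h by rewrite divr_gt0.
have hm : h < Num.min d1 d2 by rewrite /h; lra.
move: hm; rewrite lt_min => /andP[hd1 hd2].
have [s [t [sh th E]]] := mixed_difference i j x h C2u.
have [s' [t' [sh' th' E']]] := mixed_difference j i x h C2u.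
rewrite (gtr0_norm h0) in sh th sh' th'.
have := H1 s t (le_lt_trans sh hd1) (le_lt_trans th hd1).
have := H2 s' t' (le_lt_trans sh' hd2) (le_lt_trans th' hd2).
have EE : partial j (partial i u) (x + s *: delta_mx 0 i + t *: delta_mx 0 j) =
  partial i (partial j u) (x + s' *: delta_mx 0 j + t' *: delta_mx 0 i).
  apply: (@mulIf _ h); first by rewrite gt_eqF.
  apply: (@mulIf _ h); first by rewrite gt_eqF.
  refine (etrans (esym E) (etrans _ E')).
  rewrite [x + h *: delta_mx 0 i + _]addrAC.
  set a := u (_ + _ + _); set b := u (x + _); set c := u (x + _).
  ring.
rewrite EE => a1 a2.
exact: (dist_halves_absurd a1 a2).
Qed.

(** * The integral condition *)

Lemma is_derive_continuous (R : realType) (g g1 : R -> R) :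
  (forall t : R, is_derive t 1 g (g1 t)) -> continuous g.
Proof.
by move=> dg t; apply/differentiable_continuous/derivable1_diffP; case: (dg t).
Qed.

Lemma is_derive_ndecr (R : realType) (g g1 : R -> R) :
  (forall t : R, is_derive t 1 g (g1 t)) -> (forall t, 0 <= g1 t) ->
  {homo g : x y / x <= y}.
Proof.
move=> dg g10 x y xy; have [c _ E] := mean_value x y dg.
by rewrite -subr_ge0 E mulr_ge0 // subr_ge0.
Qed.

Lemma continuous_mul (R : realType) (T : topologicalType) (f g : T -> R) :
  continuous f -> continuous g -> continuous (fun x => f x * g x).
Proof. by move=> cf cg x; apply: continuousM; [exact: cf|exact: cg]. Qed.

Lemma continuous_add (R : realType) (T : topologicalType) (f g : T -> R) :
  continuous f -> continuous g -> continuous (fun x => f x + g x).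
Proof. by move=> cf cg x; apply: (@continuousD _ _ _ f g); [exact: cf|exact: cg]. Qed.

Lemma continuous_inv (R : realType) (T : topologicalType) (f : T -> R) :
  (forall x, f x != 0) -> continuous f -> continuous (fun x => (f x)^-1).
Proof. by move=> f0 cf x; apply: (@continuousV _ _ f x (f0 x)); exact: cf. Qed.

Lemma continuous_o (R : realType) (T : topologicalType) (f : T -> R) (g : R -> R) :
  continuous f -> continuous g -> continuous (fun x => g (f x)).
Proof.
by move=> cf cg x; apply: (@continuous_comp _ _ _ f g); [exact: cf|exact: cg].
Qed.

(** Vanishing on the negative half-line makes [g] integrable up to every [x], so the single formula
    [G0] is differentiable everywhere. *)
Lemma antiderivative_pos (R : realType) (g : R -> R) :
  continuous g -> (forall t, t <= 0 -> g t = 0) ->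
  exists2 G : R -> R, (forall t : R, is_derive t 1 G (g t)) &
    forall t, t <= 0 -> G t = 0.
Proof.
move=> cg g0.
pose G0 x := (\int[lebesgue_measure]_(t in [set` `]-oo, x]%R]) g t)%R.
have G0d (x : R) : is_derive x 1 G0 (g x).
  have ig : lebesgue_measure.-integrable [set` `]-oo, (x + 1)]%R] (EFin \o g).
    apply/integrable_mkcond => //.
    have -> : (EFin \o g) \_ [set` `]-oo, (x + 1)]] =
        (EFin \o g) \_ [set` `[0, (x + 1)]].
      apply/funext => t; rewrite !patchE !mem_setE !in_itv /=.
      by have [//|t0] := leP 0 t; case: ifP => //= _; rewrite g0 // ltW.
    apply/(integrable_mkcond _ _).1 => //.
    apply: continuous_compact_integrable; first exact: segment_compact.
    exact: continuous_subspaceT.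
  have x1 : x < x + 1 by rewrite ltrDl.
  have [] := continuous_FTC1 x1 ig (ltNyr _) (cg x).
  by rewrite derive1E => dG EG; apply: DeriveDef.
exists (fun x => G0 x - G0 0) => [t|t t0].
  rewrite -[g t]subr0; exact: is_deriveB.
have [c cle E] := mean_value t 0 G0d.
have c0 : c <= 0 by move: cle; rewrite sub0r normrN (ler0_norm t0) ler_norml; lra.
by rewrite -opprB E g0 // mul0r oppr0.
Qed.

Lemma integral_is_derive (R : realType) (G g : R -> R) (x y : R) :
  (forall t : R, is_derive t 1 G (g t)) -> continuous g -> x < y ->
  (\int[lebesgue_measure]_(t in `[x, y]) (g t)%:E = (G y - G x)%:E)%E.
Proof.
move=> dG cg xy; rewrite EFinB.
have cG := is_derive_continuous dG.
apply: continuous_FTC2 => //.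
- exact: continuous_subspaceT.
- split=> [t _|//|//]; first by case: (dG t).
    exact/cvg_at_right_filter/cG.
  exact/cvg_at_left_filter/cG.
- by move=> t _; rewrite derive1E; case: (dG t).
Qed.

Lemma profile (R : realType) (k : nat) (f : R -> R) :
  continuous f -> (forall t : R, 0 < t -> 0 < f t) ->
  (forall t : R, t <= 0 -> f t = 0) -> (0 < k)%N ->
  exists F P G : R -> R,
   [/\ forall t : R, is_derive t 1 F (f t ^+ k),
       forall t, t <= 0 -> F t = 0,
       forall t, 0 < P t /\ P t ^+ k.+1 = 1 + F t,
       forall t : R, is_derive t 1 P (f t ^+ k / (k.+1%:R * P t ^+ k)) &
       forall t : R, is_derive t 1 G (P t)^-1].
Proof.
move=> cf fpos f0 k0.
have cfk : continuous (fun t => f t ^+ k).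
  exact: (continuous_o cf (@exprn_continuous _ k)).
have [|F dF F0] := antiderivative_pos cfk.
  by move=> t t0; rewrite f0 // expr0n eqn0Ngt k0.
have fk0 t : 0 <= f t ^+ k.
  by apply: exprn_ge0; have [/f0 ->|/fpos/ltW] := leP t 0.
have Fge t : 0 <= F t.
  have [/F0 ->//|t0] := leP t 0.
  by rewrite -(F0 0) //; apply: (is_derive_ndecr dF) => //; exact: ltW.
have F1 t : 0 < 1 + F t by rewrite ltr_pwDl.
pose r : R := k.+1%:R^-1; pose P t := (1 + F t) `^ r.
have P0 t : 0 < P t by exact: powR_gt0.
have PX t m : P t ^+ m = (1 + F t) `^ (r * m%:R).
  by rewrite -powR_mulrn ?powR_ge0 // -powRrM.
have dP (t : R) : is_derive t 1 P (f t ^+ k / (k.+1%:R * P t ^+ k)).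
  have d1 : is_derive t 1 (fun x => 1 + F x) (f t ^+ k).
    rewrite -[f t ^+ k]add0r; exact: is_deriveD.
  rewrite (_ : _ / _ = r * (1 + F t) `^ (r - 1) * f t ^+ k).
    exact: (@is_derive1_comp R (fun x => x `^ r) (fun x => 1 + F x) t _ _
      (is_derive1_powR r (F1 t)) d1).
  rewrite (_ : r - 1 = - (r * k%:R)).
    by rewrite powRN -PX invfM -/r [LHS]mulrC.
  by rewrite /r -natr1; field; rewrite natr1 pnatr_eq0.
have cP := is_derive_continuous dP.
(* [P] equals 1 for [t <= 0], so subtracting 1 gives a function vanishing there; the linear term is
   restored afterwards. *)
have cPV : continuous (fun t => (P t)^-1 - 1).
  move=> t; apply: cvgB; last exact: cvg_cst.
  by apply: cvgV; [rewrite gt_eqF|exact: cP].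
have [|G dG _] := antiderivative_pos cPV.
  by move=> t t0; rewrite /P F0 // addr0 powR1 invr1 subrr.
exists F, P, (fun x => G x + x); split=> // t.
  by rewrite PX mulVf ?pnatr_eq0 // powRr1 // ltW.
rewrite -[(P t)^-1](subrK 1); exact: is_deriveD.
Qed.

(** On [[a, +oo[] the integrand and [1 / P] agree up to the factor [C], because [F >= F a > 0]
    there; the integral of [1 / P] diverges exactly when its primitive [G] is unbounded. *)
Lemma integral_test (R : realType) (k : nat) (f F P G : R -> R) (a : R) :
  continuous f ->
  (forall t : R, is_derive t 1 F (f t ^+ k)) -> (forall t, t <= 0 -> F t = 0) ->
  (forall t, 0 < P t /\ P t ^+ k.+1 = 1 + F t) -> continuous P ->
  (forall t : R, is_derive t 1 G (P t)^-1) -> 0 < a ->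
  {homo F : x y / x <= y} -> (forall t, 0 < t -> 0 < F t) ->
  (\int[lebesgue_measure]_(tau in `[a, +oo[)
      (((\int[lebesgue_measure]_(t in `[0, tau]) (f t ^+ k))%R
          `^ (- (k.+1%:R)^-1))%:E) = +oo)%E <-> forall B, exists u, B < G u.
Proof.
move=> cf dF F0 PF cP dG a0 Fmono Fp; have Fa := Fp _ a0.
set r : R := k.+1%:R^-1; have r0 : 0 <= r by rewrite invr_ge0.
pose T t := F t `^ (- r).
have cfk : continuous (fun t => f t ^+ k).
  exact: (continuous_o cf (@exprn_continuous _ k)).
have P0 t : 0 < P t by have [] := PF t.
have cF := is_derive_continuous dF; have cG := is_derive_continuous dG.
have Gmono : {homo G : x y / x <= y}.
  by apply: is_derive_ndecr dG _ => t; rewrite invr_ge0 ltW.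
have Fpos t : a <= t -> 0 < F t by move=> /(lt_le_trans a0) /Fp.
have PE t : P t = (1 + F t) `^ r.
  have [_ <-] := PF t; rewrite -powR_mulrn ?ltW // -powRrM /r divff ?pnatr_eq0 //.
  by rewrite powRr1 // ltW.
have PT t : a <= t -> (P t)^-1 <= T t.
  move=> /Fpos Ft; rewrite /T powRN lef_pV2 ?posrE ?powR_gt0 // PE.
  by apply: ge0_ler_powR; rewrite ?nnegrE ?addr_ge0 ?(ltW Ft) // lerDr.
pose C := (1 + (F a)^-1) `^ r.
have C0 : 0 < C by rewrite powR_gt0 // addr_gt0 // invr_gt0.
have TP t : a <= t -> T t <= C * (P t)^-1.
  move=> at_; have Ft := Fpos _ at_.
  rewrite /T powRN -[leLHS]mul1r ler_pdivrMr ?powR_gt0 // mulrAC ler_pdivlMr //.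
  rewrite mul1r /C -powRM ?(ltW Ft) ?addr_ge0 ?invr_ge0 ?(ltW Fa) // PE.
  apply: ge0_ler_powR;
    rewrite ?nnegrE ?mulr_ge0 ?addr_ge0 ?invr_ge0 ?(ltW Ft) ?(ltW Fa) //.
  rewrite mulrDl mul1r addrC lerD2l mulrC ler_pdivlMr // mul1r; exact: Fmono.
have T0 t : 0 <= T t by exact: powR_ge0.
have intT : (\int[lebesgue_measure]_(tau in `[a, +oo[)
      (((\int[lebesgue_measure]_(t in `[0, tau]) (f t ^+ k))%R
          `^ (- r))%:E) = \int[lebesgue_measure]_(tau in `[a, +oo[) (T tau)%:E)%E.
  apply: eq_integral => t; rewrite inE /= in_itv /= andbT => at_.
  have t0 : 0 < t by apply: lt_le_trans at_.
  by rewrite /Rintegral (integral_is_derive dF cfk t0) /= (F0 0) // subr0.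
rewrite intT.
have mT : measurable_fun (`[a, +oo[%classic : set R) (EFin \o T).
  apply/measurable_EFinP.
  have : measurable_fun (`]0, +oo[%classic : set R) T.
    apply: open_continuous_measurable_fun; first exact: interval_open.
    move=> t; rewrite inE /= in_itv /= andbT => t0.
    apply: (@continuous_comp _ _ _ F (fun x => x `^ (- r)) t); first exact: cF.
    apply/differentiable_continuous/derivable1_diffP.
    by have [] := is_derive1_powR (- r) (Fp _ t0).
  apply: measurable_funS => // t /=.
  by rewrite !in_itv /= !andbT; exact: lt_le_trans.
have cPV : continuous (fun t => (P t)^-1).
  by move=> t; apply: cvgV; [rewrite gt_eqF|exact: cP].
have mPV : measurable_fun (setT : set R) (EFin \o (fun t => (P t)^-1)).
  by apply/measurable_EFinP; exact: continuous_measurable_fun.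
split.
- move=> Tinf B; apply: contrapT => nB.
  have GB u : G u <= B.
    by rewrite leNgt; apply/negP => Bu; apply: nB; exists u.
  pose l := sup (range G).
  have Gl : G r @[r --> +oo] --> l.
    apply: nondecreasing_cvgr; first exact: Gmono.
    by exists B => _ [u _ <-].
  have := ge0_continuous_FTC2y (a := a) (f := fun t => (P t)^-1) (F := G) (l := l).
  move=> /(_ _ _ Gl) E.
  have {}E : (\int[lebesgue_measure]_(x in `[a, +oo[) ((P x)^-1)%:E =
      l%:E - (G a)%:E)%E.
    apply: E.
    - by move=> t _; rewrite invr_ge0 ltW.
    - exact: continuous_subspaceT.
    - by move=> t _; case: (dG t).
    - exact/cvg_at_right_filter/cG.
    - by move=> t _; rewrite derive1E; case: (dG t).
  have : (\int[lebesgue_measure]_(tau in `[a, +oo[) (T tau)%:E <=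
      \int[lebesgue_measure]_(tau in `[a, +oo[) (C%:E * ((P tau)^-1)%:E))%E.
    apply: ge0_le_integral => //.
    - by move=> t _; rewrite lee_fin.
    - apply: measurable_funeM; exact: measurable_funS mPV.
    - move=> t; rewrite /= in_itv /= andbT => at_.
      by rewrite -EFinM lee_fin TP.
  rewrite Tinf ge0_integralZl //; last 3 first.
  + exact: measurable_funS mPV.
  + by move=> t _; rewrite lee_fin invr_ge0 ltW.
  + by rewrite lee_fin ltW.
  by rewrite E -EFinB -EFinM.
- move=> Gunb; apply: contrapT => /eqP Tfin.
  have I0 : (0 <= \int[lebesgue_measure]_(tau in `[a, +oo[) (T tau)%:E)%E.
    by apply: integral_ge0 => t _; rewrite lee_fin.
  have Ifin : (\int[lebesgue_measure]_(tau in `[a, +oo[) (T tau)%:E \is a fin_num)%E.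
    by rewrite ge0_fin_numE // ltey.
  have [u] := Gunb
    (G a + fine (\int[lebesgue_measure]_(tau in `[a, +oo[) (T tau)%:E)%E).
  have [ua|au] := leP u a.
    rewrite ltNge => /negP; apply; apply: (le_trans (Gmono _ _ ua)).
    by rewrite lerDl fine_ge0.
  rewrite ltNge => /negP; apply; rewrite -lerBlDl -lee_fin fineK //.
  rewrite -(integral_is_derive dG cPV au).
  apply: (@le_trans _ _ (\int[lebesgue_measure]_(tau in `[a, u]) (T tau)%:E)%E).
    apply: ge0_le_integral => //.
    - by move=> t _; rewrite lee_fin invr_ge0 ltW.
    - exact: measurable_funS mPV.
    - apply: measurable_funS mT => // t /=.
      by rewrite !in_itv /= andbT => /andP[].
    - by move=> t; rewrite /= in_itv /= => /andP[at_ _]; rewrite lee_fin PT.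
  apply: ge0_subset_integral => //.
    by move=> t _; rewrite lee_fin.
  by move=> t /=; rewrite !in_itv /= andbT => /andP[].
Qed.

(** * The comparison argument *)

Lemma is_derive1_mul (R : realType) (f g : R -> R) (t a b : R) :
  is_derive t 1 f a -> is_derive t 1 g b ->
  is_derive t 1 (fun s => f s * g s) (a * g t + f t * b).
Proof.
move=> df dg; rewrite (_ : _ + _ = f t *: b + g t *: a).
  exact: (@is_deriveM _ _ f g t 1 a b).
by rewrite /GRing.scale /= addrC [a * _]mulrC.
Qed.

Lemma is_derive1_scale (R : realType) (f : R -> R) (c t a : R) :
  is_derive t 1 f a -> is_derive t 1 (fun s => c * f s) (c * a).
Proof.
by move=> df; have := is_derive1_mul (is_derive_cst c t 1) df; rewrite mul0r add0r.
Qed.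

Lemma is_derive1_chain (R : realType) (f g : R -> R) (t a b : R) :
  is_derive (g t) 1 f a -> is_derive t 1 g b ->
  is_derive t 1 (fun s => f (g s)) (a * b).
Proof. exact: is_derive1_comp. Qed.

Lemma is_derive1_inv (R : realType) (f : R -> R) (t a : R) :
  f t != 0 -> is_derive t 1 f a ->
  is_derive t 1 (fun s => (f s)^-1) (- a / f t ^+ 2).
Proof.
move=> ft df; rewrite (_ : - a / _ = - (f t) ^- 2 *: a).
  exact: is_deriveV.
by rewrite /GRing.scale /= mulNr mulrC mulNr.
Qed.

Lemma is_derive1_quad (R : realType) (a b c t : R) :
  is_derive t 1 (fun s => a + b * s + c * s ^+ 2) (b + c * t *+ 2).
Proof.
have dx : is_derive t 1 (fun s : R => s) 1 by exact: is_derive_id.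
have dl (d : R) : is_derive t 1 (fun s : R => d * s) d.
  by have := is_derive1_scale d dx; rewrite mulr1.
have d2 := is_derive1_mul (dl c) dx.
rewrite (_ : (fun s => _) = (fun s => a + b * s) + (fun s => c * s * s)); last first.
  by apply/funext => s; rewrite /= expr2 mulrA.
rewrite (_ : b + _ = (0 + b) + (c * t + c * t * 1)); last by rewrite mulr1 add0r mulr2n.
apply: is_deriveD => //; apply: is_deriveD => //; exact: is_derive_cst.
Qed.

Lemma is_derive_sum_scaled (R : realType) (n : nat) (h : 'I_n -> R -> R)
  (c d : 'I_n -> R) (t : R) :
  (forall i, is_derive t 1 (h i) (d i)) ->
  is_derive t 1 (fun s => \sum_(i < n) c i * h i s) (\sum_(i < n) c i * d i).
Proof.
move=> dh; rewrite (_ : (fun s => _) = \sum_(i < n) (fun s => c i * h i s)); last first.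
  by apply/funext => s; rewrite fct_sumE.
elim/big_ind2: _ => [|f1 d1 f2 d2 h1 h2|i _].
- exact: is_derive_cst.
- exact: is_deriveD.
- exact: is_derive1_scale.
Qed.

Lemma C2_second_derivative (R : realType) (n : nat) (u : 'rV[R]_n -> R)
  (z y : 'rV[R]_n) (t : R) :
  C2 u ->
  is_derive t 1 (fun s => \sum_(i < n) y 0 i * partial i u (z + s *: y))
    (\sum_(i < n) y 0 i * \sum_(j < n) y 0 j * partial j (partial i u) (z + t *: y)).
Proof.
move=> [_ ddu]; apply: is_derive_sum_scaled => i; apply/is_derive_line.
exact: C1_is_derive.
Qed.

(* At a maximum of [G \o u - sqrt (1 + |x - x0|^2)], with [G' = 1 / p]. *)
Lemma touching_from_below (R : realType) (n : nat) (u : 'rV[R]_n -> R)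
  (G p p1 : R -> R) (z zeta : 'rV[R]_n)
  (H := Num.sqrt (1 + \sum_(i < n) zeta 0 i ^+ 2)) :
  C2 u -> (forall t, 0 < p t) -> (forall t : R, is_derive t 1 p (p1 t)) ->
  (forall t, 0 <= p1 t) ->
  (forall t : R, is_derive t 1 G (p t)^-1) ->
  (forall y, G (u (z + y)) - Num.sqrt (1 + \sum_(i < n) (zeta + y) 0 i ^+ 2) <=
     G (u z) - H) ->
  forall y : 'rV[R]_n, let b := (\sum_(i < n) zeta 0 i * y 0 i) / H in
  \sum_(i < n) y 0 i * partial i u z = p (u z) * b /\
  \sum_(i < n) y 0 i * \sum_(j < n) y 0 j * partial j (partial i u) z <=
    p (u z) * (\sum_(i < n) y 0 i ^+ 2) + p (u z) * p1 (u z) * b ^+ 2.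
Proof.
move=> C2u p0 dp p10 dG zmax y b.
pose al := \sum_(i < n) zeta 0 i ^+ 2; pose be := \sum_(i < n) zeta 0 i * y 0 i.
pose ga := \sum_(i < n) y 0 i ^+ 2.
(* [q] is the squared value of [sqrt (1 + |.|^2)] along the line, and [S] its root; the maximum is
   then a one-variable problem at [t = 0]. *)
pose q (t : R) := 1 + al + be *+ 2 * t + ga * t ^+ 2.
have qE t : 1 + \sum_(i < n) (zeta + t *: y) 0 i ^+ 2 = q t.
  rewrite /q -!addrA; congr (_ + _).
  rewrite -mulr_natl /be mulr_sumr mulr_suml mulr_suml -!big_split /=.
  by apply: eq_bigr => i _; rewrite !mxE; ring.
have q0 t : 0 < q t.
  by rewrite -qE ltr_pwDl // sumr_ge0 // => i _; exact: sqr_ge0.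
have dq (t : R) : is_derive t 1 q (be *+ 2 + ga * t *+ 2) by exact: is_derive1_quad.
pose S t := Num.sqrt (q t).
have S0 t : 0 < S t by rewrite sqrtr_gt0.
have dS (t : R) : is_derive t 1 S ((be + ga * t) * (S t)^-1).
  rewrite (_ : _ * _ = (2 * S t)^-1 * (be *+ 2 + ga * t *+ 2)).
    by apply: (is_derive1_chain (is_derive1_sqrt (q0 t)) (dq t)).
  by rewrite -mulrnDl -mulr_natl; field; rewrite gt_eqF.
pose U t := u (z + t *: y).
pose D t := \sum_(i < n) y 0 i * partial i u (z + t *: y).
have dU (t : R) : is_derive t 1 U (D t).
  by apply/is_derive_line; apply: C1_is_derive; exact: C2u.1.
pose Q := \sum_(i < n) y 0 i * \sum_(j < n) y 0 j * partial j (partial i u) z.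
have dD : is_derive (0 : R) 1 D Q.
  have z0 : z + 0 *: y = z by rewrite scale0r addr0.
  by have := C2_second_derivative z y 0 C2u; rewrite z0.
pose g t := G (U t) - S t.
pose g1 t := (p (U t))^-1 * D t - (be + ga * t) * (S t)^-1.
have dg (t : R) : is_derive t 1 g (g1 t).
  apply: is_deriveB; exact: (is_derive1_chain (dG _) (dU t)).
have dl : is_derive (0 : R) 1 (fun t => be + ga * t) ga.
  have := is_derive1_quad be ga 0 (0 : R).
  rewrite (_ : (fun s => _) = (fun t => be + ga * t)); last first.
    by apply/funext => s; rewrite mul0r addr0.
  by rewrite mul0r mul0rn addr0.
have dpV : is_derive (0 : R) 1 (fun t => (p (U t))^-1)
    (- (p1 (U 0) * D 0) / p (U 0) ^+ 2).
  exact: (@is_derive1_inv R (fun t => p (U t)) 0 _ (lt0r_neq0 (p0 _))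
    (is_derive1_chain (dp _) (dU 0))).
have dg1 := is_deriveB (is_derive1_mul dpV dD)
  (is_derive1_mul dl (is_derive1_inv (lt0r_neq0 (S0 0)) (dS 0))).
have [|g10 g2] := second_derivative_max dg dg1.
  move=> t; rewrite /g /U /S -!qE !scale0r !addr0; exact: zmax.
have U0 : U 0 = u z by rewrite /U scale0r addr0.
have S0E : S 0 = H by rewrite /S -qE scale0r addr0.
have D0 : D 0 = \sum_(i < n) y 0 i * partial i u z.
  by rewrite /D scale0r addr0.
have H0 : 0 < H by rewrite -S0E.
have p0' := p0 (u z).
have DE : D 0 = p (u z) * b.
  move: g10; rewrite /g1 U0 S0E mulr0 addr0 => /eqP; rewrite subr_eq0 => /eqP E.
  by rewrite -[LHS](mulKf (lt0r_neq0 p0')) mulrCA E.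
split; first by rewrite -D0.
rewrite -/Q -/ga.
have H1 : 1 <= H.
  rewrite -[leLHS]sqrtr1; apply: ler_wsqrtr.
  by rewrite lerDl sumr_ge0 // => i _; exact: sqr_ge0.
have ga0 : 0 <= ga by rewrite sumr_ge0 // => i _; exact: sqr_ge0.
move: g2; rewrite DE U0 S0E mulr0 addr0.
have -> : be = b * H by rewrite /b divfK ?gt_eqF.
move: (p (u z)) p0' => P P0; move: (p1 (u z)) => P1.
(* The term [b ^+ 2 / H] has the favourable sign, and [H >= 1] bounds [ga / H] by [ga]; this is
   convexity and the Hessian bound for [sqrt (1 + |x|^2)]. *)
rewrite (_ : _ + _ - _ = Q / P - (P1 * b ^+ 2 + ga / H - b ^+ 2 / H)); last first.
  by field; rewrite !gt_eqF.
rewrite subr_le0 ler_pdivrMr // => /le_trans; apply.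
rewrite -mulrA -mulrDr [leRHS]mulrC ler_wpM2r ?(ltW P0) //.
have : ga / H <= ga by rewrite ler_pdivrMr // ler_peMr.
have : 0 <= b ^+ 2 / H by rewrite divr_ge0 ?sqr_ge0 // ltW.
lra.
Qed.

Lemma le_of_derive_gt0 (R : realType) (G g : R -> R) (x y : R) :
  (forall t : R, is_derive t 1 G (g t)) -> (forall t, 0 < g t) ->
  G x <= G y -> x <= y.
Proof.
move=> dG g0; rewrite !leNgt; apply: contra => yx.
have [c _ E] := mean_value y x dG.
by rewrite -subr_gt0 E mulr_gt0 // subr_gt0.
Qed.

Lemma enormZ (R : realType) (n : nat) (c : R) (v : 'rV[R]_n) :
  enorm (c *: v) = `|c| * enorm v.
Proof.
rewrite /enorm (eq_bigr (fun i => c ^+ 2 * v 0 i ^+ 2)) => [|i _].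
  by rewrite -mulr_sumr sqrtrM ?sqr_ge0 // sqrtr_sqr.
by rewrite mxE exprMn.
Qed.

Lemma enorm_sqr (R : realType) (n : nat) (v : 'rV[R]_n) :
  enorm v ^+ 2 = \sum_(i < n) v 0 i ^+ 2.
Proof. by rewrite sqr_sqrtr // sumr_ge0 // => i _; exact: sqr_ge0. Qed.

(** The superlevel set through [x0] is closed and bounded, hence compact, and a maximum over it is
    global. *)
Lemma attained_max (R : realType) (n : nat) (W : 'rV[R]_n -> R) (B : R)
  (x0 : 'rV[R]_n) :
  continuous W -> (forall x, W x <= B - enorm (x - x0)) ->
  exists z, forall x, W x <= W z.
Proof.
move=> cW WB.
pose A := [set x | W x0 <= W x].
have coord x i : `|(x - x0) 0 i| <= enorm (x - x0).
  have e0 : 0 <= enorm (x - x0) by exact: sqrtr_ge0.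
  rewrite -ler_sqr ?nnegrE // real_normK ?num_real // enorm_sqr.
  by rewrite (bigD1 i) //= lerDl sumr_ge0 // => j _; exact: sqr_ge0.
have cA : compact A.
  apply: bounded_closed_compact.
    exists (`|x0| + (B - W x0)); split; first exact: num_real.
    move=> M hM x /= Ax; have {}Ax : W x0 <= W x := Ax.
    have xB : enorm (x - x0) <= B - W x0 by have := WB x; lra.
    have B0 : 0 <= B - W x0 by apply: le_trans xB; exact: sqrtr_ge0.
    apply: ltW; apply: le_lt_trans hM; rewrite -[x](subrK x0).
    apply: le_trans (ler_normD _ _) _; rewrite addrC lerD2l.
    rewrite {1}/Num.norm /= mx_normrE bigmax_le // => -[i j] _ /=.
    by rewrite [i]ord1; apply: le_trans (coord _ _) _.
  rewrite (_ : A = W @^-1` [set y | W x0 <= y]) //.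
  by apply: closed_comp => [x _|]; [exact: cW|exact: closed_ge].
have [z zA zmax] := EVT_max_rV (ex_intro _ x0 (lexx (W x0))) cA
  (continuous_subspaceT cW).
exists z => x; have [Ax|Ax] := pselect (A x).
  by apply: zmax; rewrite inE.
move: zA; rewrite inE; apply: le_trans.
by move/negP: Ax; rewrite -ltNge => /ltW.
Qed.

Lemma continuous_sum_rV (R : realType) (n m : nat) (h : 'I_m -> 'rV[R]_n -> R) :
  (forall i, continuous (h i)) -> continuous (fun x => \sum_(i < m) h i x).
Proof.
move=> ch; rewrite (_ : (fun x => _) = \sum_(i < m) h i); last first.
  by apply/funext => x; rewrite fct_sumE.
elim/big_ind: _ => [|f g cf cg|i _]; first exact: cst_continuous.
  by move=> x; apply: continuousD; [exact: cf|exact: cg].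
exact: ch.
Qed.

Lemma sqdist_continuous (R : realType) (n : nat) (x0 : 'rV[R]_n) :
  continuous (fun x : 'rV[R]_n => \sum_(i < n) (x - x0) 0 i ^+ 2).
Proof.
apply: continuous_sum_rV => i x.
apply: (@continuous_comp _ _ _ (fun x : 'rV[R]_n => (x - x0) 0 i) (fun x => x ^+ 2)).
  rewrite (_ : (fun x => _) = (fun x : 'rV[R]_n => x 0 i - x0 0 i)); last first.
    by apply/funext => t; rewrite !mxE.
  apply: (@continuousB _ _ _ (fun x : 'rV[R]_n => x 0 i) (fun=> x0 0 i)).
    exact: coord_continuous.
  exact: cst_continuous.
exact: exprn_continuous.
Qed.

Lemma quad_add_scalar (R : realType) (n : nat) (A : 'M[R]_n) (c : R)
  (y : 'rV[R]_n) :
  (y *m (A + c%:M) *m y^T) 0 0 =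
  \sum_(i < n) y 0 i * (\sum_(j < n) y 0 j * A i j) + c * (y *m y^T) 0 0.
Proof.
rewrite mulmxDr mulmxDl mxE; congr (_ + _); last first.
  by rewrite mul_mx_scalar -scalemxAl mxE.
rewrite mxE; under eq_bigr do rewrite mxE mulr_suml.
rewrite exchange_big; apply: eq_bigr => i _; rewrite mulr_sumr.
by apply: eq_bigr => j _; rewrite mxE; ring.
Qed.

(** [K] depends only on n, k and [mu], so [p] may be scaled down after [K] is known. The weight [h]
    is least at [x0] and [G] is increasing, so passing to the maximum point does not decrease
    [u]. *)
Lemma comparison (R : realType) (n k : nat) (mu : R) : (0 < k <= n.+1)%N ->
  exists2 K : R, 0 < K & forall (u : 'rV[R]_n.+1 -> R) (G p p1 : R -> R) (B : R)
    (x0 : 'rV[R]_n.+1),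
    admissible k mu u -> (forall t, 0 < p t) ->
    (forall t : R, is_derive t 1 p (p1 t)) -> (forall t, 0 <= p1 t) ->
    (forall t : R, is_derive t 1 G (p t)^-1) -> (forall x, G (u x) <= B) ->
    exists2 z, u x0 <= u z &
      S_mx k (aug_hess mu u z) <= K * (p (u z) ^+ k * (1 + p1 (u z))).
Proof.
move=> kn; have k0 : (0 < k)%N by case/andP: kn.
have [K0 K00 HK] := S_mx_le R kn.
have m0 : 0 < 1 + `|mu| by rewrite ltr_pwDl.
exists (K0 * (1 + `|mu|) ^+ k); first by rewrite mulr_gt0 // exprn_gt0.
move=> u G p p1 B x0 [C2u Gu] p0 dp p10 dG GB.
pose h (x : 'rV[R]_n.+1) := Num.sqrt (1 + \sum_(i < n.+1) (x - x0) 0 i ^+ 2).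
pose W x := G (u x) - h x.
have cW : continuous W.
  move=> x; apply: (@continuousB _ _ _ (fun x => G (u x)) h).
    apply: (@continuous_comp _ _ _ u G); first exact: C2u.1.1.
    exact: (is_derive_continuous dG).
  apply: (@continuous_comp _ _ _ (fun x : 'rV[R]_n.+1 =>
    1 + \sum_(i < n.+1) (x - x0) 0 i ^+ 2) Num.sqrt); last exact: sqrt_continuous.
  apply: (@continuousD _ _ _ (fun _ : 'rV[R]_n.+1 => 1 : R) (fun x : 'rV[R]_n.+1 =>
    \sum_(i < n.+1) (x - x0) 0 i ^+ 2)); first exact: cst_continuous.
  exact: sqdist_continuous.
have [x|z zmax] := attained_max (x0 := x0) (B := B) cW.
  rewrite /W lerB //; apply: ler_wsqrtr; by rewrite lerDr.
exists z.
  apply: (le_of_derive_gt0 dG) => [t|]; first by rewrite invr_gt0.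
  have := zmax x0; rewrite /W.
  have : h x0 <= h z.
    apply: ler_wsqrtr; rewrite lerD2l big1 => [|i _].
      by rewrite sumr_ge0 // => i _; exact: sqr_ge0.
    by rewrite !mxE subrr expr0n.
  lra.
pose zeta := z - x0; pose H := Num.sqrt (1 + \sum_(i < n.+1) zeta 0 i ^+ 2).
have s0 : 0 <= \sum_(i < n.+1) zeta 0 i ^+ 2.
  by rewrite sumr_ge0 // => i _; exact: sqr_ge0.
have H0 : 0 < H by rewrite sqrtr_gt0 ltr_pwDl.
have touch : forall y : 'rV[R]_n.+1,
  let b := (\sum_(i < n.+1) zeta 0 i * y 0 i) / H in
  \sum_(i < n.+1) y 0 i * partial i u z = p (u z) * b /\
  \sum_(i < n.+1) y 0 i * \sum_(j < n.+1) y 0 j * partial j (partial i u) z <=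
    p (u z) * (\sum_(i < n.+1) y 0 i ^+ 2) + p (u z) * p1 (u z) * b ^+ 2.
  apply: (@touching_from_below R n.+1 u G p p1 z zeta C2u p0 dp p10 dG) => y.
  have := zmax (z + y); rewrite /W /h (_ : z + y - x0 = zeta + y) //.
  by rewrite /zeta addrAC.
pose g := H^-1 *: zeta.
have g1 : enorm g <= 1.
  rewrite enormZ gtr0_norm ?invr_gt0 // mulrC ler_pdivrMr // mul1r.
  by apply: ler_wsqrtr; rewrite lerDr.
have yg (y : 'rV[R]_n.+1) :
    (y *m g^T) 0 0 = (\sum_(i < n.+1) zeta 0 i * y 0 i) / H.
  rewrite mxE mulr_suml; apply: eq_bigr => i _; rewrite !mxE; ring.
have yy (y : 'rV[R]_n.+1) : (y *m y^T) 0 0 = \sum_(i < n.+1) y 0 i ^+ 2.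
  by rewrite mxE; apply: eq_bigr => i _; rewrite mxE expr2.
have gradE : grad u z = p (u z) *: g.
  apply/rowP => i; have [+ _] := touch (delta_mx 0 i).
  rewrite (bigD1 i) //= big1 => [|j ji]; last by rewrite mxE (negbTE ji) mul0r.
  rewrite !mxE !eqxx mul1r addr0 => ->; congr (_ * _).
  rewrite (bigD1 i) //= big1 => [|j ji]; last by rewrite !mxE (negbTE ji) mulr0.
  by rewrite !mxE !eqxx mulr1 addr0 mulrC.
have P0 := p0 (u z); have P10 := p10 (u z).
have gradle : enorm (grad u z) <= p (u z).
  by rewrite gradE enormZ gtr0_norm // ler_piMr // ltW.
have grad0 : 0 <= enorm (grad u z) by exact: sqrtr_ge0.
(* Since [|Du| <= p (u z)] at this point, the first-order term adds at most [|mu| * p (u z)] to the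
   coefficient of the identity. *)
have := HK (aug_hess mu u z) g ((1 + `|mu|) * p (u z)) (p (u z) * p1 (u z)).
move=> /(_ _ _ _ g1 _ (Gu z)) HS.
apply: le_trans (HS _ _ _ _) _.
- rewrite /aug_hess linearD /= tr_scalar_mx; congr (_ + _).
  by apply/matrixP => i j; rewrite !mxE; exact: hessian_symmetric.
- exact: mulr_gt0.
- by rewrite mulr_ge0 // ltW.
- move=> y; rewrite /aug_hess quad_add_scalar yy yg.
  have [_ +] := touch y; set b := _ / H; set q := \sum_i _ ^+ 2.
  rewrite (eq_bigr (fun i => y 0 i * \sum_j y 0 j * hess u z i j)); last first.
    by move=> i _; congr (_ * _); apply: eq_bigr => j _; rewrite mxE.
  move=> h1; have q0 : 0 <= q by rewrite sumr_ge0 // => i _; exact: sqr_ge0.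
  have : mu * enorm (grad u z) * q <= `|mu| * p (u z) * q.
    rewrite ler_wpM2r //; apply: le_trans (ler_norm _) _.
    by rewrite normrM (ger0_norm grad0) ler_wpM2l.
  lra.
have -> : K0 * (1 + `|mu|) ^+ k * (p (u z) ^+ k * (1 + p1 (u z))) =
    K0 * (((1 + `|mu|) * p (u z) + (1 + `|mu|) * (p (u z) * p1 (u z))) *
      ((1 + `|mu|) * p (u z)) ^+ k.-1).
  by rewrite -[in LHS](prednK k0) !exprS exprMn; ring.
rewrite ler_wpM2l ?(ltW K00) // ler_wpM2r ?exprn_ge0 ?mulr_ge0 ?(ltW P0) //.
rewrite lerD2l ler_peMl ?mulr_ge0 ?(ltW P0) //; by rewrite lerDl.
Qed.

Lemma subsolution_pow (R : realType) (n k : nat) (mu : R) (f : R -> R)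
  (u : 'rV[R]_n -> R) (x : 'rV[R]_n) :
  (0 < k)%N -> subsolution k mu f u -> 0 <= f (u x) ->
  f (u x) ^+ k <= S_mx k (aug_hess mu u x).
Proof.
move=> k0 [[_ Gu] sub] f0.
have S0 : 0 < S_mx k (aug_hess mu u x) by apply: Gu; rewrite k0 leqnn.
have := sub x; set s := S_mx _ _ in S0 * => fs.
apply: (@le_trans _ _ ((s `^ k%:R^-1) ^+ k)).
  by rewrite lerXn2r ?nnegrE ?powR_ge0.
rewrite -powR_mulrn ?powR_ge0 // -powRrM mulVf ?pnatr_eq0 -?lt0n //.
by rewrite powRr1 // ltW.
Qed.

Lemma primitive_le (R : realType) (k : nat) (f F : R -> R) (u : R) :
  (0 < k)%N ->
  (forall t : R, 0 < t -> 0 < f t) ->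
  (forall s t : R, 0 < s -> s <= t -> f s <= f t) ->
  (forall t : R, t <= 0 -> f t = 0) ->
  (forall t : R, is_derive t 1 F (f t ^+ k)) -> F 0 = 0 -> 0 < u ->
  F u <= u * f u ^+ k.
Proof.
move=> k0 fpos fmono f0 dF F0 u0; have [c] := mean_value 0 u dF.
rewrite F0 !subr0 (gtr0_norm u0) => cu ->; rewrite mulrC ler_wpM2l ?(ltW u0) //.
have {}cu : c <= u by apply: le_trans cu; exact: ler_norm.
rewrite lerXn2r ?nnegrE ?(ltW (fpos _ u0)) //.
  by have [/f0 ->|/fpos/ltW] := leP c 0.
by have [/f0 ->|c0] := leP c 0; [exact/ltW/fpos|exact: fmono].
Qed.

Lemma primitive_gt0 (R : realType) (k : nat) (f F : R -> R) (u : R) :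
  (forall t : R, 0 < t -> 0 < f t) ->
  (forall t : R, is_derive t 1 F (f t ^+ k)) -> F 0 = 0 -> 0 < u -> 0 < F u.
Proof.
move=> fpos dF F0 u0.
have cF := is_derive_continuous dF.
have [c] := MVT u0 (fun t _ => dF t) (continuous_subspaceT cF).
rewrite in_itv /= F0 !subr0 => /andP[c0 _] ->.
by rewrite mulr_gt0 // exprn_gt0 // fpos.
Qed.

(** On [[a, t]] the derivative of [G] is at least [1 / P t], so a bounded [G] forces [P] to grow at
    least linearly. As [P ^ k.+1 = 1 + F] is at most a multiple of [t * f t ^+ k], division by [P t]
    removes the factor [t]. *)
Lemma profile_bound (R : realType) (k : nat) (f F P G : R -> R) (a B : R) :
  (0 < k)%N ->
  (forall t : R, 0 < t -> 0 < f t) ->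
  (forall s t : R, 0 < s -> s <= t -> f s <= f t) ->
  (forall t : R, t <= 0 -> f t = 0) ->
  (forall t : R, is_derive t 1 F (f t ^+ k)) -> F 0 = 0 ->
  {homo F : x y / x <= y} -> {homo P : x y / x <= y} ->
  (forall t, 0 < P t /\ P t ^+ k.+1 = 1 + F t) ->
  (forall t : R, is_derive t 1 G (P t)^-1) -> 0 < a ->
  (forall t, G t <= B) ->
  exists2 C, 0 < C & forall t, 2 * a <= t -> P t ^+ k <= C * f t ^+ k.
Proof.
move=> k0 fpos fmono f0 dF F0 Fmono Pmono PF dG a0 GB.
have P0 t : 0 < P t by have [] := PF t.
have Fa : 0 < F a by apply: primitive_gt0 dF F0 a0.
have D t : a <= t -> t - a <= (B - G a) * P t.
  move=> at_; have [c ca E] := mean_value a t dG.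
  have ct : c <= t.
    move: ca; rewrite (ger0_norm (_ : 0 <= t - a)) ?subr_ge0 // ler_norml; lra.
  have : G t - G a <= B - G a by rewrite lerD2r.
  rewrite E mulrC ler_pdivrMr // => /le_trans; apply.
  rewrite ler_wpM2l ?Pmono // subr_ge0; exact: GB.
have B0 : 0 < B - G a.
  have a1 : a <= a + 1 by rewrite lerDl.
  have := D _ a1; have := P0 (a + 1); nra.
exists ((1 + (F a)^-1) * (2 * (B - G a))).
  by rewrite !mulr_gt0 // addr_gt0 // invr_gt0.
move=> t at_; have t0 : 0 < t by lra.
have Ft := primitive_le k0 fpos fmono f0 dF F0 t0.
have fk0 : 0 <= f t ^+ k by apply/exprn_ge0/ltW/fpos.
have at' : a <= t by lra.
have -> : P t ^+ k = (1 + F t) / P t.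
  by have [_ <-] := PF t; rewrite exprSr mulfK // gt_eqF.
rewrite ler_pdivrMr //.
have h1 : 1 + F t <= (1 + (F a)^-1) * F t.
  rewrite mulrDl mul1r addrC lerD2l mulrC ler_pdivlMr // mul1r; exact: Fmono.
apply: (le_trans h1); rewrite -!mulrA ler_wpM2l ?addr_ge0 ?invr_ge0 ?(ltW Fa) //.
apply: (le_trans Ft); have := D _ at'; have := P0 t => Pt hD.
(* The threshold [2 * a] gives [t <= 2 * (t - a)]. *)
have h2 : t <= 2 * ((B - G a) * P t) by lra.
apply: le_trans (ler_wpM2r fk0 h2) _.
by rewrite le_eqVlt; apply/orP; left; apply/eqP; ring.
Qed.

Lemma necessity (R : realType) (n k : nat) (mu : R) (f F P G : R -> R) (a B : R)
  (u : 'rV[R]_n.+1 -> R) :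
  (0 < k <= n.+1)%N ->
  (forall t : R, 0 < t -> 0 < f t) ->
  (forall s t : R, 0 < s -> s <= t -> f s <= f t) ->
  (forall t : R, t <= 0 -> f t = 0) ->
  (forall t : R, is_derive t 1 F (f t ^+ k)) -> F 0 = 0 ->
  {homo F : x y / x <= y} -> {homo P : x y / x <= y} ->
  (forall t, 0 < P t /\ P t ^+ k.+1 = 1 + F t) ->
  (forall t : R, is_derive t 1 P (f t ^+ k / (k.+1%:R * P t ^+ k))) ->
  (forall t : R, is_derive t 1 G (P t)^-1) -> 0 < a ->
  (forall t, G t <= B) ->
  subsolution k mu f u -> (forall x, 0 < u x) -> False.
Proof.
move=> kn fpos fmono f0 dF F0 Fmono Pmono PF dP dG a0 GB sub upos.
have k0 : (0 < k)%N by case/andP: kn.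
have [K K0 cmp] := comparison mu kn.
have fge t : 0 <= f t by have [/f0 ->|/fpos/ltW] := leP t 0.
have fu x := subsolution_pow k0 sub (fge (u x)).
have cX c : 0 < c -> c <= 1 -> c ^+ k <= c.
  move=> c0 c1; rewrite -(prednK k0) exprS ler_piMr ?(ltW c0) //.
  by rewrite exprn_ile1 // ltW.
have P0 t : 0 < P t by have [] := PF t.
(* Either [u] reaches the range where [profile_bound] applies, and the comparison point stays in it,
   or [u] is bounded by [2 * a]. *)
have [[x0 ux0]|small] := pselect (exists x, 2 * a <= u x).
  have [C C0 PC] := profile_bound k0 fpos fmono f0 dF F0 Fmono Pmono PF dG a0 GB.
  have KC : 0 < 2 * (K * (C + 1)) by rewrite !mulr_gt0 // addr_gt0.
  (* Chosen so that the comparison yields [f ^ k <= f ^ k / 2]; [c <= 1] allows [c ^+ k <= c]. *)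
  pose c := Num.min 1 (2 * (K * (C + 1)))^-1.
  have c0 : 0 < c by rewrite lt_min ltr01 invr_gt0.
  have c1 : c <= 1 by rewrite ge_min lexx.
  have cK : c * (2 * (K * (C + 1))) <= 1.
    by rewrite -ler_pdivlMr // mul1r ge_min lexx orbT.
  have cn0 : c != 0 by rewrite gt_eqF.
  have [z uz S1] : exists2 z, u x0 <= u z & S_mx k (aug_hess mu u z) <=
      K * ((c * P (u z)) ^+ k * (1 + c * (f (u z) ^+ k / (k.+1%:R * P (u z) ^+ k)))).
    apply: (cmp u (fun t => c^-1 * G t) (fun t => c * P t)
      (fun t => c * (f t ^+ k / (k.+1%:R * P t ^+ k))) (c^-1 * B) x0 sub.1).
    - by move=> t; exact: mulr_gt0 c0 (P0 t).
    - move=> t; rewrite mulr_ge0 ?(ltW c0) // divr_ge0 ?exprn_ge0 //.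
      by rewrite mulr_ge0 // exprn_ge0 // ltW.
    - by move=> t; rewrite invfM; exact: (is_derive1_scale c^-1 (dG t)).
    - by move=> x; rewrite ler_wpM2l // invr_ge0 ltW.
  have := le_trans (fu z) S1; apply/negP; rewrite -ltNge.
  have az : 2 * a <= u z by apply: le_trans uz.
  have fk : 0 < f (u z) ^+ k by rewrite exprn_gt0 // fpos.
  have Pk := PC _ az; have Pk0 : 0 < P (u z) ^+ k by rewrite exprn_gt0.
  have kS : 1 <= k.+1%:R :> R by rewrite ler1n.
  have -> : (c * P (u z)) ^+ k * (1 + c * (f (u z) ^+ k / (k.+1%:R * P (u z) ^+ k))) =
      c ^+ k * (P (u z) ^+ k + c * (f (u z) ^+ k / k.+1%:R)).
    rewrite exprMn; field.
    by rewrite nat1r pnatr_eq0 /= expf_neq0 // gt_eqF.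
  have h1 : P (u z) ^+ k + c * (f (u z) ^+ k / k.+1%:R) <= (C + 1) * f (u z) ^+ k.
    rewrite mulrDl lerD // -[leRHS]mul1r; apply: ler_pM => //.
    - exact: ltW.
    - by rewrite divr_ge0 // ltW.
    - by rewrite mul1r ler_pdivrMr ?(lt_le_trans ltr01) // ler_peMr // ltW.
  have h2 : K * (c ^+ k * (P (u z) ^+ k + c * (f (u z) ^+ k / k.+1%:R))) <=
      K * (c * ((C + 1) * f (u z) ^+ k)).
    rewrite ler_wpM2l ?(ltW K0) //; apply: ler_pM => //.
    - by rewrite exprn_ge0 // ltW.
    - by rewrite addr_ge0 ?(ltW Pk0) // mulr_ge0 ?divr_ge0 ?(ltW c0) ?(ltW fk).
    - exact: cX.
  apply: (le_lt_trans h2).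
  have -> : K * (c * ((C + 1) * f (u z) ^+ k)) =
    c * (2 * (K * (C + 1))) * (f (u z) ^+ k / 2) by field.
  apply: (@le_lt_trans _ _ (f (u z) ^+ k / 2)); last lra.
  by rewrite ler_piMl // divr_ge0 // ltW.
pose x0 : 'rV[R]_n.+1 := 0.
have fk : 0 < f (u x0) ^+ k by rewrite exprn_gt0 // fpos.
(* With [p] constantly [c], the comparison gives [S_k <= K * c ^+ k], at most half of
   [f (u x0) ^+ k], while monotonicity makes [f (u z)] no smaller than [f (u x0)]. *)
pose c := Num.min 1 (f (u x0) ^+ k / (2 * K)).
have K2 : 0 < 2 * K by rewrite mulr_gt0.
have c0 : 0 < c by rewrite lt_min ltr01 divr_gt0.
have c1 : c <= 1 by rewrite ge_min lexx.
have cK : c * (2 * K) <= f (u x0) ^+ k by rewrite -ler_pdivlMr // ge_min lexx orbT.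
have [z uz S1] : exists2 z, u x0 <= u z &
    S_mx k (aug_hess mu u z) <= K * (c ^+ k * (1 + 0)).
  apply: (cmp u (fun t => c^-1 * t) (fun=> c) (fun=> 0) (c^-1 * (2 * a)) x0 sub.1).
  - by [].
  - by [].
  - move=> t; have d := is_derive1_scale c^-1 (is_derive_id t 1).
    rewrite mulr1 in d; exact: d.
  - move=> x; rewrite ler_wpM2l ?invr_ge0 ?(ltW c0) // leNgt; apply/negP => h.
    by apply: small; exists x; exact: ltW.
have fz : f (u x0) ^+ k <= f (u z) ^+ k by rewrite lerXn2r ?nnegrE // fmono.
have := le_trans fz (le_trans (fu z) S1); apply/negP; rewrite -ltNge addr0 mulr1.
have h : K * c ^+ k <= K * c by rewrite ler_wpM2l ?(ltW K0) // cX.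
lra.
Qed.

(** * Construction of a subsolution *)

(* Separation of variables: the inverse of a primitive of [1 / p] solves
   [phi' = p phi]. *)
Lemma autonomous_solution (R : realType) (G p : R -> R) :
  (forall t, 0 < p t) -> (forall t : R, is_derive t 1 G (p t)^-1) ->
  (forall B, exists t, B < G t) -> (forall B, exists t, G t < B) ->
  exists phi : R -> R, [/\ cancel G phi, cancel phi G &
    forall s : R, is_derive s 1 phi (p (phi s))].
Proof.
move=> p0 dG Gtop Gbot.
have cG := is_derive_continuous dG.
have pV0 t : 0 < (p t)^-1 by rewrite invr_gt0.
have inc x y : G x <= G y -> x <= y by exact: (le_of_derive_gt0 dG).
have ex s : exists t, G t = s.
  have [t1 h1] := Gbot s; have [t2 h2] := Gtop s.
  have t12 : t1 <= t2 by apply: inc; exact/ltW/(lt_trans h1).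
  have [|t _ <-] := IVT t12 (continuous_subspaceT cG) (v := s); last by exists t.
  by rewrite ge_min le_max (ltW h1) (ltW h2) orbT.
have [phi phiK] := choice ex.
have Gphi : cancel G phi.
  by move=> t; apply/eqP; rewrite eq_le; apply/andP; split; apply: inc; rewrite phiK.
exists phi; split=> // s; rewrite -{1}(phiK s) -[p _]invrK.
apply: is_derive_inverse; last by rewrite gt_eqF.
- by near=> x; exact: Gphi.
- by near=> x; exact: cG.
Unshelve. all: by end_near.
Qed.

(** For [s = |x|^2 / 2] the Hessian of [psi s] has the eigenvalue [psi1 + 2 s psi2] along [x] and
    [psi1] across. The last inequality holds [psi1 / 2] and [2 s kap psi1] of the former in reserve,
    to absorb the first-order term when k = 1. *)
Lemma radial_profile (R : realType) (k : nat) (kap : R) (f P G : R -> R) :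
  (0 < k)%N -> 0 < kap -> continuous f ->
  (forall t : R, 0 < t -> 0 < f t) ->
  (forall s t : R, 0 < s -> s <= t -> f s <= f t) ->
  (forall t : R, t <= 0 -> f t = 0) ->
  {homo P : x y / x <= y} ->
  (forall t, 1 <= P t) ->
  (forall t : R, is_derive t 1 P (f t ^+ k / (k.+1%:R * P t ^+ k))) ->
  (forall t : R, is_derive t 1 G (P t)^-1) ->
  (forall B, exists t, B < G t) -> (forall B, exists t, G t < B) ->
  exists psi psi1 psi2 : R -> R,
   [/\ forall s : R, is_derive s 1 psi (psi1 s),
       forall s : R, is_derive s 1 psi1 (psi2 s), continuous psi2 &
       forall s, 0 <= s -> [/\ 0 < psi s, 0 < psi1 s, kap * psi1 s <= psi2 s &
         f (psi s) ^+ k <=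
           (psi1 s / 2 + 2 * s * (psi2 s - kap * psi1 s)) * psi1 s ^+ k.-1]].
Proof.
move=> k0 kap0 cf fpos fmono f0 Pmono P1 dP dG Gtop Gbot.
have fge t : 0 <= f t by have [/f0 ->|/fpos/ltW] := leP t 0.
have P0 t : 0 < P t by apply: lt_le_trans (P1 t).
have kS : 0 < k.+1%:R :> R by [].
(* The summand 1 gives [c <= c ^+ k], the second settles the values [v <= 2], the third the values
   [v > 2]. *)
pose c := 1 + 2 * f 2 ^+ k + P 2 * k.+1%:R.
have fk2 : 0 <= f 2 ^+ k by rewrite exprn_ge0.
have Pk2 : 0 <= P 2 * k.+1%:R by rewrite mulr_ge0 // ltW.
have c1 : 1 <= c by rewrite /c; lra.
have c0 : 0 < c by apply: lt_le_trans c1.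
have ck : c <= c ^+ k by rewrite -[leLHS]expr1 ler_weXn2l.
pose p t := c * P t; pose p1 t := c * (f t ^+ k / (k.+1%:R * P t ^+ k)).
have p0 t : 0 < p t by rewrite mulr_gt0.
have dp (t : R) : is_derive t 1 p (p1 t) by exact: is_derive1_scale.
have p10 t : 0 <= p1 t.
  rewrite mulr_ge0 ?(ltW c0) // divr_ge0 ?exprn_ge0 //.
  by rewrite mulr_ge0 // exprn_ge0 // ltW.
pose Gc t := c^-1 * (G t - G 1).
have dGc (t : R) : is_derive t 1 Gc (p t)^-1.
  rewrite /p invfM; apply: is_derive1_scale; rewrite -[(P t)^-1]subr0.
  exact: is_deriveB.
have [||phi [Gphi phiG dphi]] := autonomous_solution p0 dGc.
- move=> B; have [t ht] := Gtop (c * B + G 1); exists t.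
  by rewrite /Gc mulrC ltr_pdivlMr // mulrC; lra.
- move=> B; have [t ht] := Gbot (c * B + G 1); exists t.
  by rewrite /Gc mulrC ltr_pdivrMr // mulrC; lra.
have phimono : {homo phi : x y / x <= y}.
  by apply: is_derive_ndecr dphi _ => t; exact: ltW.
have Gc1 : Gc 1 = 0 by rewrite /Gc subrr mulr0.
have phi0 : phi 0 = 1 by rewrite -Gc1 Gphi.
(* [E'' = kap * E'], which puts the term [kap * psi1] into [psi2]. *)
pose E s := kap^-1 * (expR (kap * s) - 1); pose E1 s := expR (kap * s).
have dl (s : R) : is_derive s 1 (fun s => kap * s) kap.
  have d := is_derive1_scale kap (is_derive_id s 1).
  by rewrite mulr1 in d; exact: d.
have dE1 (s : R) : is_derive s 1 E1 (E1 s * kap).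
  exact: (is_derive1_chain (is_derive_expR _) (dl s)).
have dE (s : R) : is_derive s 1 E (E1 s).
  rewrite (_ : E1 s = kap^-1 * (E1 s * kap - 0)); last first.
    by rewrite subr0 mulrC mulfK // gt_eqF.
  apply: is_derive1_scale; exact: is_deriveB.
have E10 s : 0 < E1 s by exact: expR_gt0.
pose psi s := phi (E s); pose psi1 s := p (psi s) * E1 s.
pose psi2 s := p1 (psi s) * psi1 s * E1 s + p (psi s) * (E1 s * kap).
have dpsi (s : R) : is_derive s 1 psi (psi1 s).
  exact: (is_derive1_chain (dphi _) (dE s)).
have dpsi1 (s : R) : is_derive s 1 psi1 (psi2 s).
  exact: (is_derive1_mul (is_derive1_chain (dp _) (dpsi s)) (dE1 s)).
exists psi, psi1, psi2; split=> //.
  have cpsi := is_derive_continuous dpsi; have cpsi1 := is_derive_continuous dpsi1.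
  have cE1 := is_derive_continuous dE1; have cp := is_derive_continuous dp.
  have cP := is_derive_continuous dP.
  have cX : continuous (fun x : R => x ^+ k) by exact: exprn_continuous.
  have cp1 : continuous p1.
    apply: continuous_mul; first exact: cst_continuous.
    apply: continuous_mul; first exact: (continuous_o cf cX).
    apply: continuous_inv => [t|].
      by rewrite mulf_neq0 ?pnatr_eq0 // expf_neq0 // gt_eqF.
    apply: continuous_mul; first exact: cst_continuous.
    exact: (continuous_o cP cX).
  apply: continuous_add.
    apply: continuous_mul => //; apply: continuous_mul => //.
    exact: (continuous_o cpsi cp1).
  apply: continuous_mul; first exact: (continuous_o cpsi cp).
  by apply: continuous_mul => //; exact: cst_continuous.
move=> s s0.
have E0 : E 0 = 0 by rewrite /E mulr0 expR0 subrr mulr0.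
have E1ge : 1 <= E1 s by rewrite /E1 -expR0 ler_expR mulr_ge0 // ltW.
have Es0 : 0 <= E s by rewrite /E mulr_ge0 ?invr_ge0 ?(ltW kap0) // subr_ge0.
have sE : E s <= s * E1 s.
  have [r] := mean_value 0 s dE; rewrite E0 !subr0 (ger0_norm s0) => rs ->.
  rewrite mulrC ler_wpM2l // ler_expR ler_wpM2l ?(ltW kap0) //.
  by apply: le_trans rs; exact: ler_norm.
set v := psi s.
have v1 : 1 <= v by rewrite -phi0; exact: phimono.
have v0 : 0 < v by lra.
have pv := p0 v; have p1v := p10 v.
have psi1p : p v <= psi1 s by rewrite ler_peMr // ltW.
have psi10 : 0 < psi1 s by rewrite mulr_gt0.
have psi2E : psi2 s = kap * psi1 s + p1 v * p v * E1 s * E1 s.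
  by rewrite /psi2 /psi1 -/v; ring.
have w0 : 0 <= p1 v * p v by rewrite mulr_ge0 // ltW.
have e0 := ltW (E10 s).
split=> //; first by rewrite psi2E lerDl; exact: mulr_ge0 (mulr_ge0 w0 e0) e0.
rewrite psi2E [kap * _ + _]addrC addrK.
(* The estimate in the variable [E s]; [sE] and [E1 s >= 1] then transfer it to [s]. *)
have key : f v ^+ k <= (p v / 2 + 2 * E s * (p1 v * p v)) * p v ^+ k.-1.
  have -> : (p v / 2 + 2 * E s * (p1 v * p v)) * p v ^+ k.-1 =
      p v ^+ k / 2 + 2 * E s * (p1 v * p v ^+ k).
    rewrite -[X in p v ^+ X / 2](prednK k0) -[X in p1 v * p v ^+ X](prednK k0).
    by rewrite !exprS; ring.
  have pk : 0 <= p v ^+ k by rewrite exprn_ge0 // ltW.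
  (* Near the origin [E s] is too small to help, and [p v ^+ k / 2] alone dominates. Once [v]
     exceeds 2, [E s] is at least the time [phi] takes to climb from 1 to 2, hence at least
     [(c * P 2)^-1]. *)
  have [v2|v2] := leP v 2.
    apply: (@le_trans _ _ (p v ^+ k / 2)); last first.
      by rewrite lerDl; apply: mulr_ge0 (mulr_ge0 _ Es0) (mulr_ge0 p1v pk).
    have h1 : f v ^+ k <= f 2 ^+ k by rewrite lerXn2r ?nnegrE // fmono.
    have h2 : c ^+ k <= p v ^+ k.
      by rewrite lerXn2r ?nnegrE ?(ltW c0) ?(ltW pv) // ler_peMr // ltW.
    by rewrite /c in ck; lra.
  apply: (@le_trans _ _ (2 * E s * (p1 v * p v ^+ k))); last first.
    by rewrite lerDr divr_ge0.
  have fv : 0 < f v ^+ k by rewrite exprn_gt0 // fpos.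
  have -> : p1 v * p v ^+ k = c * c ^+ k * f v ^+ k / k.+1%:R.
    rewrite /p1 /p exprMn; field.
    by rewrite nat1r pnatr_eq0 /= expf_neq0 // gt_eqF.
  have Ege : (c * P 2)^-1 <= E s.
    have -> : E s = Gc v by rewrite /v /psi phiG.
    have [r] := mean_value 1 2 dGc; rewrite (_ : (2 : R) - 1 = 1); last by lra.
    rewrite normr1 mulr1 ler_distl => /andP[_ r2] eG.
    have : Gc 2 <= Gc v.
      by apply: (is_derive_ndecr dGc); [move=> t; rewrite invr_ge0 ltW|exact: ltW].
    have -> : Gc 2 = (p r)^-1 by rewrite -eG Gc1 subr0.
    apply: le_trans; rewrite lef_pV2 ?posrE ?mulr_gt0 // ler_wpM2l ?(ltW c0) //.
    by apply: Pmono; lra.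
  have h : 1 <= 2 * (c * P 2)^-1 * (c * c ^+ k / k.+1%:R).
    have -> : 2 * (c * P 2)^-1 * (c * c ^+ k / k.+1%:R) = 2 * c ^+ k / (P 2 * k.+1%:R).
      by field; rewrite nat1r pnatr_eq0 /= !gt_eqF.
    rewrite ler_pdivlMr ?mulr_gt0 // mul1r; rewrite /c in ck; lra.
  have -> : 2 * E s * (c * c ^+ k * f v ^+ k / k.+1%:R) =
    2 * E s * (c * c ^+ k / k.+1%:R) * f v ^+ k by ring.
  rewrite ler_peMl ?(ltW fv) //; apply: (le_trans h).
  rewrite ler_wpM2r ?divr_ge0 ?mulr_ge0 ?exprn_ge0 ?(ltW c0) //.
  by rewrite ler_wpM2l.
apply: (le_trans key); apply: ler_pM.
- apply: addr_ge0; first by rewrite divr_ge0 ?(ltW pv).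
  exact: mulr_ge0 (mulr_ge0 (ler0n _ 2) Es0) w0.
- by rewrite exprn_ge0 // ltW.
- rewrite lerD ?ler_wpM2r ?invr_ge0 //.
  have -> : 2 * s * (p1 v * p v * E1 s * E1 s) =
     2 * (s * E1 s) * (p1 v * p v) * E1 s by ring.
  apply: (@le_trans _ _ (2 * (s * E1 s) * (p1 v * p v))).
    by rewrite ler_wpM2r // ler_wpM2l.
  rewrite ler_peMr //; apply: mulr_ge0 w0.
  exact: mulr_ge0 (ler0n _ 2) (mulr_ge0 s0 e0).
- by rewrite lerXn2r ?nnegrE ?(ltW pv) ?(ltW psi10).
Qed.

Lemma half_sqnorm_line (R : realType) (n : nat) (x : 'rV[R]_n) (i : 'I_n) (t : R) :
  (\sum_(j < n) (x + t *: delta_mx 0 i) 0 j ^+ 2) / 2 =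
  (\sum_(j < n) x 0 j ^+ 2) / 2 + x 0 i * t + 2^-1 * t ^+ 2.
Proof.
rewrite (bigD1 i) //= [in RHS](bigD1 i) //= !mxE !eqxx mulr1.
rewrite (eq_bigr (fun j => x 0 j ^+ 2)) => [|j ji]; last first.
  by rewrite !mxE (negbTE ji) mulr0 addr0.
by move: (\sum_(j < n | _) _) => S; field.
Qed.

Lemma is_derive_radial (R : realType) (n : nat) (g g1 : R -> R) (x : 'rV[R]_n)
  (i : 'I_n) :
  (forall s : R, is_derive s 1 g (g1 s)) ->
  is_derive x (delta_mx 0 i) (fun y => g ((\sum_(j < n) y 0 j ^+ 2) / 2))
    (g1 ((\sum_(j < n) x 0 j ^+ 2) / 2) * x 0 i).
Proof.
move=> dg; rewrite -[x in is_derive x]addr0 -(scale0r (delta_mx 0 i)).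
apply/is_derive_line => /=.
under eq_fun do rewrite half_sqnorm_line.
set q := (\sum_(j < n) x 0 j ^+ 2) / 2.
have d := is_derive1_quad q (x 0 i) 2^-1 (0 : R).
rewrite mulr0 mul0rn addr0 in d.
have := @is_derive1_chain R g (fun s => q + x 0 i * s + 2^-1 * s ^+ 2) 0 _ _ (dg _) d.
by rewrite mulr0 expr0n mulr0 !addr0.
Qed.

(** The variable [|x|^2 / 2], whose gradient is [x], avoids the singularity of [|x|] at the
    origin. *)
Lemma radial_C2 (R : realType) (n : nat) (psi psi1 psi2 : R -> R) :
  (forall s : R, is_derive s 1 psi (psi1 s)) ->
  (forall s : R, is_derive s 1 psi1 (psi2 s)) -> continuous psi2 ->
  let q := fun x : 'rV[R]_n => (\sum_(j < n) x 0 j ^+ 2) / 2 in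
  let u := fun x => psi (q x) in
  [/\ C2 u, forall x, grad u x = psi1 (q x) *: x &
    forall x, hess u x = (psi1 (q x))%:M + psi2 (q x) *: (x^T *m x)].
Proof.
move=> d1 d2 c2 q u.
have cq : continuous q.
  apply: continuous_mul; last exact: cst_continuous.
  apply: continuous_sum_rV => i; 
    apply: (@continuous_o R _ (fun x : 'rV[R]_n => x 0 i) (fun x => x ^+ 2)).
    exact: coord_continuous.
  exact: exprn_continuous.
have cpsi := is_derive_continuous d1; have cpsi1 := is_derive_continuous d2.
have cx i : continuous (fun x : 'rV[R]_n => x 0 i) by exact: coord_continuous.
have dX (x : 'rV[R]_n) (i j : 'I_n) :
    is_derive x (delta_mx 0 j) (fun y : 'rV[R]_n => y 0 i) (i == j)%:R.
  rewrite -[x in is_derive x]addr0 -(scale0r (delta_mx 0 j)).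
  apply/is_derive_line => /=.
  rewrite (_ : (fun s => _) = (fun s => x 0 i + (i == j)%:R * s + 0 * s ^+ 2)).
    have := is_derive1_quad (x 0 i) (i == j)%:R 0 (0 : R).
    by rewrite mul0r mul0rn addr0.
  by apply/funext => s; rewrite !mxE eqxx /=; ring.
have pu i : partial i u = fun x => psi1 (q x) * x 0 i.
  by apply/funext => x; have [_] := is_derive_radial x i d1.
have d2u (x : 'rV[R]_n) (i j : 'I_n) :
    is_derive x (delta_mx 0 j) (fun y => psi1 (q y) * y 0 i)
     (psi2 (q x) * x 0 j * x 0 i + psi1 (q x) * (i == j)%:R).
  have := @is_deriveM _ _ (fun y => psi1 (q y)) (fun y : 'rV[R]_n => y 0 i) x
    (delta_mx 0 j) _ _ (is_derive_radial x j d2) (dX x i j).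
  rewrite /GRing.scale /= -/(q x) [X in is_derive _ _ _ X -> _]addrC.
  by rewrite [x 0 i * _]mulrC.
have p2u i j : partial j (partial i u) =
    fun x => psi2 (q x) * x 0 j * x 0 i + psi1 (q x) * (i == j)%:R.
  by rewrite pu; apply/funext => x; have [_] := d2u x i j.
split.
- split.
    split; first exact: (continuous_o cq cpsi).
    move=> i; split; first by move=> x; have [] := is_derive_radial x i d1.
    rewrite pu; apply: continuous_mul => //; exact: (continuous_o cq cpsi1).
  move=> i; split.
    rewrite pu; apply: continuous_mul => //; exact: (continuous_o cq cpsi1).
  move=> j; split; first by move=> x; rewrite pu; have [] := d2u x i j.
  rewrite p2u; apply: continuous_add.
    apply: continuous_mul => //; apply: continuous_mul => //.
    exact: (continuous_o cq c2).
  apply: continuous_mul; first exact: (continuous_o cq cpsi1).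
  exact: cst_continuous.
- by move=> x; apply/rowP => i; rewrite !mxE pu.
move=> x; apply/matrixP => i j; rewrite !mxE p2u big_ord1 !mxE mulr_natr addrC.
by congr (_ + _); ring.
Qed.

Lemma sufficiency (R : realType) (n k : nat) (mu : R) (f P G : R -> R) :
  (0 < k <= n.+1)%N -> k = 1%N \/ 0 <= mu -> continuous f ->
  (forall t : R, 0 < t -> 0 < f t) ->
  (forall s t : R, 0 < s -> s <= t -> f s <= f t) ->
  (forall t : R, t <= 0 -> f t = 0) ->
  {homo P : x y / x <= y} ->
  (forall t, 1 <= P t) ->
  (forall t : R, is_derive t 1 P (f t ^+ k / (k.+1%:R * P t ^+ k))) ->
  (forall t : R, is_derive t 1 G (P t)^-1) ->
  (forall B, exists t, B < G t) -> (forall B, exists t, G t < B) ->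
  exists u : 'rV[R]_n.+1 -> R, subsolution k mu f u /\ (forall x, 0 < u x).
Proof.
move=> kn kmu cf fpos fmono f0 Pmono P1 dP dG Gtop Gbot.
have k0 : (0 < k)%N by case/andP: kn.
have fge t : 0 <= f t by have [/f0 ->|/fpos/ltW] := leP t 0.
pose N : R := n.+1%:R; pose kap := (N * mu) ^+ 2 + 1.
have N1 : 1 <= N by rewrite ler1n.
have kap0 : 0 < kap by rewrite ltr_wpDl // sqr_ge0.
have [psi [psi1 [psi2 [d1 d2 c2 psiP]]]] :=
  radial_profile k0 kap0 cf fpos fmono f0 Pmono P1 dP dG Gtop Gbot.
pose q (x : 'rV[R]_n.+1) : R := (\sum_(i < n.+1) x 0 i ^+ 2) / 2.
pose u x := psi (q x).
have [C2u gradE hessE] := @radial_C2 R n.+1 psi psi1 psi2 d1 d2 c2.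
rewrite -/q -/u in C2u gradE hessE.
have q0 x : 0 <= q x.
  by rewrite divr_ge0 // sumr_ge0 // => i _; exact: sqr_ge0.
have augE (x : 'rV[R]_n.+1) : aug_hess mu u x =
    (psi1 (q x) * (1 + mu * enorm x))%:M + psi2 (q x) *: (x^T *m x).
  have [_ p1 _ _] := psiP _ (q0 x).
  rewrite /aug_hess hessE gradE enormZ gtr0_norm // addrAC -raddfD /=.
  by congr (_%:M + _); ring.
have qE (x : 'rV[R]_n.+1) : enorm x ^+ 2 = 2 * q x.
  by rewrite enorm_sqr /q mulrC divfK.
have e0 (x : 'rV[R]_n.+1) : 0 <= enorm x by exact: sqrtr_ge0.
have key x : Gamma k (eigenvalues (aug_hess mu u x)) /\
    f (u x) ^+ k <= S_mx k (aug_hess mu u x).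
  have [p0 p1 p2 fle] := psiP _ (q0 x).
  have ex := e0 x; rewrite augE; set a := psi1 (q x) in p1 p2 fle *.
  set b := psi2 (q x) in p2 fle *.
  have b0 : 0 <= b by apply: le_trans p2; rewrite mulr_ge0 // ltW.
  (* For [mu >= 0] the first-order term only enlarges the roots; for k = 1 the trace alone has to be
     estimated. *)
  case: kmu => [k1|mu0]; last first.
    have a0 : 0 < a * (1 + mu * enorm x).
      by rewrite mulr_gt0 // ltr_pwDl // mulr_ge0.
    have [gam Sle] := Gamma_rank_one x kn a0 b0; split=> //.
    apply: (le_trans fle); apply: le_trans Sle.
    have aa : a <= a * (1 + mu * enorm x).
      by rewrite ler_peMr ?(ltW p1) // lerDl mulr_ge0.
    apply: ler_pM.
    - rewrite addr_ge0 ?divr_ge0 ?(ltW p1) //.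
      by rewrite (mulr_ge0 (mulr_ge0 (ler0n _ 2) (q0 x))) // subr_ge0.
    - by rewrite exprn_ge0 // ltW.
    - rewrite qE [b * _]mulrC lerD //.
        by apply: le_trans aa; rewrite ler_pdivrMr // ler_peMr ?ler1n // ltW.
      apply: ler_wpM2l; first exact: mulr_ge0 (ler0n _ 2) (q0 x).
      by rewrite gerBl (mulr_ge0 (ltW kap0) (ltW p1)).
    - by rewrite lerXn2r ?nnegrE ?(ltW p1) ?(ltW a0).
  have S1 := esym1_rank_one (a * (1 + mu * enorm x)) b x.
  have le1 : f (u x) ^+ k <= esym_poly 1 (eigenvalues
      ((a * (1 + mu * enorm x))%:M + b *: (x^T *m x))).
    rewrite S1; apply: (le_trans fle); rewrite k1 expr0 mulr1 -/N.
    rewrite -subr_ge0 -qE; set r := enorm x.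
    have -> : N * (a * (1 + mu * r)) + b * r ^+ 2 -
        (a / 2 + r ^+ 2 * (b - kap * a)) =
        a * (N - 2^-1 + N * mu * r + kap * r ^+ 2) by field.
    rewrite mulr_ge0 ?(ltW p1) // /kap.
    (* Completing the square in [r]: the origin of [kap = (N * mu) ^+ 2 + 1]. *)
    have -> : N - 2^-1 + N * mu * r + ((N * mu) ^+ 2 + 1) * r ^+ 2 =
      (N - 1) + (N * mu * r + 2^-1) ^+ 2 + 4^-1 + r ^+ 2 by field.
    have := sqr_ge0 (N * mu * r + 2^-1); have := sqr_ge0 r; lra.
  rewrite k1 in le1; rewrite /S_mx k1; split=> // p /andP[pge ple].
  have -> : p = 1%N by lia.
  apply: lt_le_trans le1; by rewrite expr1; exact: fpos.
exists u; split; last by move=> x; have [] := psiP _ (q0 x).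
split; first by split=> // x; have [] := key x.
move=> x; have [_ h] := key x.
have -> : f (u x) = (f (u x) ^+ k) `^ k%:R^-1.
  rewrite -powR_mulrn // -powRrM divff ?powRr1 //.
  by rewrite pnatr_eq0 -lt0n.
apply: ge0_ler_powR; rewrite ?nnegrE ?invr_ge0 ?exprn_ge0 //.
by apply: le_trans h; rewrite exprn_ge0.
Qed.

Theorem theorem1p3 (R : realType) (n k : nat) (mu : R) (f : R -> R) (a : R)
  (hn : (1 <= n)%N) (hk : (1 <= k <= n)%N)
  (f_cont : continuous f)
  (f_pos : forall t : R, 0 < t -> 0 < f t)
  (f_mono : forall s t : R, 0 < s -> s <= t -> f s <= f t)
  (f_zero : forall t : R, t <= 0 -> f t = 0)
  (hmu : (k = 1%N /\ mu < mu0 R n k) \/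
         ((2 <= k <= n)%N /\ 0 <= mu < mu0 R n k))
  (ha : 0 < a) :
  (exists u : 'rV[R]_n -> R,
      subsolution k mu f u /\ (forall x : 'rV[R]_n, 0 < u x)) <->
  (\int[lebesgue_measure]_(tau in `[a, +oo[)
      (((\int[lebesgue_measure]_(t in `[0, tau]) (f t ^+ k))%R
          `^ (- (k.+1%:R)^-1))%:E) = +oo)%E.
Proof.
case: n hn hk hmu => // n _ hk hmu.
have k0 : (0 < k)%N by case/andP: hk.
have kmu : k = 1%N \/ 0 <= mu.
  by case: hmu => [[k1 _]|[_ /andP[m0 _]]]; [left|right].
have fge t : 0 <= f t by have [/f_zero ->|/f_pos/ltW] := leP t 0.
have [F [P [G [dF F0 PF dP dG]]]] := profile f_cont f_pos f_zero k0.
have F00 : F 0 = 0 by exact: F0.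
have P0 t : 0 < P t by have [] := PF t.
have Fmono : {homo F : x y / x <= y}.
  by apply: is_derive_ndecr dF _ => t; exact: exprn_ge0.
have Fpos t : 0 < t -> 0 < F t by exact: primitive_gt0 f_pos dF F00.
have Pmono : {homo P : x y / x <= y}.
  apply: is_derive_ndecr dP _ => t; rewrite divr_ge0 ?exprn_ge0 //.
  by rewrite mulr_ge0 // exprn_ge0 // ltW.
have P1 t : 1 <= P t.
  have [Pt PE] := PF t; rewrite -(expr_ge1 (ltn0Sn k)) ?(ltW Pt) // PE lerDl.
  by have [/F0 ->|/Fpos/ltW] := leP t 0.
have cP := is_derive_continuous dP.
rewrite (integral_test f_cont dF F0 PF cP dG ha Fmono Fpos).
split=> [[u [sub upos]] B|Gtop].
  apply: contrapT => nB; apply: (necessity (B := B) hk f_pos f_mono f_zero dF F00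
    Fmono Pmono PF dP dG ha _ sub upos) => t.
  by rewrite leNgt; apply/negP => Bt; apply: nB; exists t.
apply: (sufficiency hk kmu f_cont f_pos f_mono f_zero Pmono P1 dP dG Gtop) => B.
(* For [t <= 0] the derivative of [G] on [[t, 0]] is at least [1 / P 0], so from 0 down to this [t]
   it drops by at least [|G 0 - B| + 1]. *)
pose t := - (P 0 * (`|G 0 - B| + 1)); exists t.
have w0 : 0 < `|G 0 - B| + 1 by rewrite ltr_pwDr.
have t0 : t <= 0 by rewrite oppr_le0 mulr_ge0 // ltW.
have [c] := mean_value t 0 dG; rewrite sub0r normrN (ler0_norm t0) => ct E.
have c0 : c <= 0 by move: ct; rewrite ler_norml; lra.
have : (P 0)^-1 * - t <= G 0 - G t.
  by rewrite E ler_wpM2r ?oppr_ge0 // lef_pV2 ?posrE // Pmono.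
rewrite /t opprK mulKf ?gt_eqF //; have := ler_norm (G 0 - B); lra.
Qed.
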